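(* Let $p\ge1$, $s\in(0,1)$ with $sp<1$, and $T\in\mathbb{N}$. The unique critical point (up to translations) of $\mathcal{F}^s_p$ in $\mathbb{X}^0_T$ is the equispaced configuration $\mathbf{X}^{\mathrm{eq}}=\mathbb{Z}$. Moreover, $\mathbf{X}^{\mathrm{eq}}$ is the unique (up to translations) local and global minimiser of $\mathcal{F}^s_p$ in $\mathbb{X}_T$.
   Context: One-dimensional setting. Let $T\in\mathbb{N}$. A configuration is a set $\mathbf{X}=\bigcup_{k\in\mathbb{Z}}(\bar{\mathbf{X}}+kT)$ with $\bar{\mathbf{X}}=(x_1,\dots,x_T)\in[0,T)^T$, $x_i\le x_j$ for $i<j$ (points counted with multiplicity); $\mathbb{X}_T$ is the set of configurations, identified with the vectors $\bar{\mathbf{X}}$ (local minimality is with respect to the positions $x_1,\dots,x_T$). $\mathrm{d}[\mathbf{X}]$ is the minimal distance $|x_i-x_j|$ between points with distinct indices, and $\mathbb{X}^0_T$ is the set of configurations with $\mathrm{d}[\mathbf{X}]>0$. Translations: $\mathbf{X}+a=\{x+a:x\in\mathbf{X}\}$, $a\in\mathbb{R}$. For $\mathbf{X}\in\mathbb{X}_T$, $u[\mathbf{X}]$ is the $T$-periodic function (defined up to an additive constant) with distributional derivative $\mathrm{D}u[\mathbf{X}]=\mathcal{L}^1-\sum_{x\in\mathbf{X}}\delta_x$ (multiplicities counted), and $\mathcal{F}^s_p[\mathbf{X}]=\int_0^T\int_{\mathbb{R}}\frac{|u[\mathbf{X}](x)-u[\mathbf{X}](y)|^p}{|x-y|^{1+sp}}\,\mathrm{d}y\,\mathrm{d}x$.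 A critical point in $\mathbb{X}^0_T$ is a configuration at which all the derivatives $\frac{\mathrm{d}}{\mathrm{d}h}\mathcal{F}^s_p[\mathbf{X}+he_i]\big|_{h=0}$, $i=1,\dots,T$, vanish, where $\mathbf{X}+he_i$ is obtained by replacing $x_i$ with $x_i+h$ (and its periodic copies accordingly). *)

(* Defs.v *)
From HB Require Import structures.
From mathcomp Require Import all_boot all_order all_algebra.
From mathcomp Require Import all_classical all_reals all_analysis.
Set Implicit Arguments. Unset Strict Implicit. Unset Printing Implicit Defensive.
Import Order.TTheory GRing.Theory Num.Theory.
Import numFieldNormedType.Exports.
Local Open Scope classical_set_scope.
Local Open Scope ring_scope.

Section Defs.
Variable R : realType.

(* A configuration in X_T is represented by its vector of positions
   (x_0, ..., x_{T-1}) (0-indexed); the periodic set is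
   { x_i + k T : i < T, k in Z }. *)
Definition inXT (T : nat) (X : 'I_T -> R) : Prop :=
  (forall i, 0 <= X i < T%:R) /\ (forall i j : 'I_T, (i <= j)%N -> X i <= X j).

Definition inX0T (T : nat) (X : 'I_T -> R) : Prop :=
  inXT X /\ (forall i j : 'I_T, i != j -> 0 < `|X i - X j|).

(* The periodic point set (as a set; multiplicities are irrelevant where used). *)
Definition perset (T : nat) (X : 'I_T -> R) : set R :=
  [set y | exists (i : 'I_T) (k : int), y = X i + k%:~R * T%:R].

(* u[X]: T-periodic, D u = L^1 - sum_{x in X} delta_x (with multiplicity);
   defined up to an additive constant. Works for any vector of positions. *)
Definition u_of (T : nat) (X : 'I_T -> R) (x : R) : R :=
  x - \sum_(i < T) (Num.floor ((x - X i) / T%:R))%:~R.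

Definition Fsp (s p : R) (T : nat) (X : 'I_T -> R) : \bar R :=
  (\int[lebesgue_measure]_(x in `[0%R, T%:R]%classic)
     \int[lebesgue_measure]_(y in [set: R])
        ((`|u_of X x - u_of X y| `^ p) / (`|x - y| `^ (1 + s * p)))%:E)%E.

(* X + h e_i : replace x_i by x_i + h (periodic copies follow). *)
Definition perturb (T : nat) (X : 'I_T -> R) (i : 'I_T) (h : R) : 'I_T -> R :=
  fun j => if j == i then X j + h else X j.

Definition critical_X0 (s p : R) (T : nat) (X : 'I_T -> R) : Prop :=
  inX0T X /\
  forall i : 'I_T, is_derive (0 : R) (1 : R) (fun h : R => fine (Fsp s p (perturb X i h))) 0.

Definition local_min_XT (s p : R) (T : nat) (X : 'I_T -> R) : Prop :=
  inXT X /\ exists2 e : R, 0 < e &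
    forall Y : 'I_T -> R, inXT Y -> (forall i, `|Y i - X i| < e) ->
      (Fsp s p X <= Fsp s p Y)%E.

Definition global_min_XT (s p : R) (T : nat) (X : 'I_T -> R) : Prop :=
  inXT X /\ forall Y : 'I_T -> R, inXT Y -> (Fsp s p X <= Fsp s p Y)%E.

Definition Xeq (T : nat) : 'I_T -> R := fun i => (i : nat)%:R.

Definition translate_of_Xeq (T : nat) (X : 'I_T -> R) : Prop :=
  exists a : R, perset X = perset (fun i : 'I_T => Xeq i + a).

End Defs.

(* Main.v *)
Require Import Defs.
From HB Require Import structures.
From mathcomp Require Import all_boot all_order all_algebra.
From mathcomp Require Import all_classical all_reals all_analysis.
From mathcomp Require Import measurable_realfun.
From mathcomp Require Import zify ring lra.
Set Implicit Arguments.
Unset Strict Implicit.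
Unset Printing Implicit Defensive.
Import Order.TTheory GRing.Theory Num.Theory.
Import numFieldNormedType.Exports.
Local Open Scope ring_scope.

(** Writing y = x + z and using Tonelli, F[X] is the integral over z of |z|^(-1-sp) times
    the integral over a period of phi_z(N), where phi_z(k) = |k - z|^p is convex on the integers
    and N is the number of points of X in (x, x + z].  A discrete Taylor formula expands phi_z(N)
    into an affine part, whose mean does not depend on X, plus nonnegative multiples of (N - k)_+;
    and the integral of (N - k)_+ over a period equals the sum over i < T of
    (z - (x_(i+k) - x_i))_+, which is a convex function of the positions.  Hence F is convex in X, and
    since the gaps x_(i+k) - x_i have mean k, Jensen's inequality shows that the lattice is a global
    minimiser for each z separately; a gap shorter than 1 makes the inequality strict for z
    between the gap and 1.

    Local minimisers are global by convexity.  A critical point X is the barycentre of the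
    lattice and of one-point perturbations of X, so convexity and the vanishing of the partial
    derivatives give F[X] <= F[lattice], without any joint differentiability.  At the lattice, moving
    one point by h changes the inner integral by O(h), and only for z within |h| of a nonzero
    integer, so F changes by o(h). *)

(** * Counting points of a periodic configuration *)

Section Combinatorics.
Variables (R : realType) (n : nat).
Local Notation T := n.+1.
Implicit Types (X Y : 'I_T -> R) (x z : R) (i : 'I_T) (j k : int).

(* The bi-infinite nondecreasing enumeration of the periodic configuration, with multiplicities. *)
Definition xe X (j : int) : R :=
  X (inord `|(j %% T)%Z|%N) + (j %/ T)%Z%:~R * T%:R.

(* Ordered configurations up to translation: unlike [inXT], this is stable under small perturbations of distinct points. *)
Definition cyc X : Prop :=
  (forall i i' : 'I_T, (i <= i')%N -> X i <= X i') /\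
  (forall i i' : 'I_T, X i' <= X i + T%:R).

Lemma xe_ord X i : xe X (i : nat) = X i.
Proof.
rewrite /xe modz_small ?divz_small; last 2 first.
- by apply/andP; split => //; rewrite ltz_nat ltn_ord.
- by apply/andP; split => //; rewrite ltz_nat ltn_ord.
by rewrite absz_nat mul0r addr0 inord_val.
Qed.

Lemma xeDT X j k : xe X (j + k * T%:Z) = xe X j + k%:~R * T%:R.
Proof.
rewrite /xe [j + _]addrC modzMDl divzMDl// intrD; ring.
Qed.

Lemma xe_Xeq j : xe (@Xeq R T) j = j%:~R.
Proof.
rewrite /xe /Xeq inordK; last by have := ltz_mod j (isT : T%:Z != 0); have := modz_ge0 j (isT : T%:Z != 0); lia.
have h : (`|(j %% T)%Z|%N : int) = (j %% T)%Z.
  by rewrite gez0_abs// modz_ge0.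
rewrite [in RHS](divz_eq j T) intrD intrM addrC -[(T%:Z)%:~R]/(T%:R); congr (_ + _).
by rewrite -{}[in RHS]h.
Qed.

(** [j] selects the same coordinate and the same period for every configuration, so [xe] is affine
    in [X]; the constant multiple of [T] survives because the weights sum to 1. *)
Lemma xe_affine (m : nat) (l : 'I_m -> R) (Y : 'I_m -> 'I_T -> R) j :
  \sum_a l a = 1 ->
  xe (fun i => \sum_a l a * Y a i) j = \sum_a l a * xe (Y a) j.
Proof.
move=> l1; rewrite /xe; under [RHS]eq_bigr do rewrite mulrDr.
by rewrite big_split/= -mulr_suml l1 mul1r.
Qed.

Lemma cyc_comb (m : nat) (l : 'I_m -> R) (Y : 'I_m -> 'I_T -> R) :
  (forall a, 0 <= l a) -> \sum_a l a = 1 -> (forall a, cyc (Y a)) ->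
  cyc (fun i => \sum_a l a * Y a i).
Proof.
move=> l0 l1 cY; split => [i i' ii'|i i'].
  by apply: ler_sum => a _; apply: ler_wpM2l => //; apply: (cY a).1.
have -> : T%:R = \sum_a l a * T%:R :> R by rewrite -mulr_suml l1 mul1r.
rewrite -big_split/=; apply: ler_sum => a _.
by rewrite -mulrDr; apply: ler_wpM2l => //; apply: (cY a).2.
Qed.

Lemma cyc_inXT X : inXT X -> cyc X.
Proof.
move=> [X0 Xle]; split => // i i'.
have /andP[_ /ltW] := X0 i'; have /andP[] := X0 i; lra.
Qed.

(** Inside one block of [T] indices the first clause of [cyc] applies; from one block to a later
    one, the second clause bounds the drop in position by [T]. *)
Lemma xe_homo X : cyc X -> {homo xe X : j k / j <= k}.
Proof.
move=> [cX1 cX2] j k jk; rewrite /xe.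
set r := inord _; set r' := inord _.
have rE : (r : nat) = `|(j %% T)%Z|%N.
  by rewrite inordK//; have := ltz_mod j (isT : T%:Z != 0); have := modz_ge0 j (isT : T%:Z != 0); lia.
have r'E : (r' : nat) = `|(k %% T)%Z|%N.
  by rewrite inordK//; have := ltz_mod k (isT : T%:Z != 0); have := modz_ge0 k (isT : T%:Z != 0); lia.
have [e|ne] := eqVneq (j %/ T)%Z (k %/ T)%Z.
  rewrite e lerD2r; apply: cX1.
  have := modz_ge0 j (isT : T%:Z != 0); have := modz_ge0 k (isT : T%:Z != 0).
  move: jk; rewrite {1}(divz_eq j T) {1}(divz_eq k T) e rE r'E; lia.
have lt : (j %/ T)%Z + 1 <= (k %/ T)%Z.
  have : (j %/ T)%Z <= (k %/ T)%Z by apply: lez_pdiv2r.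
  move: ne; lia.
have {}lt : (j %/ T)%Z%:~R + 1 <= (k %/ T)%Z%:~R :> R.
  by rewrite -[1]/(1%:~R) -intrD ler_int.
have := cX2 r' r.
have := ler_wpM2r (ler0n R T) lt; rewrite mulrDl mul1r; lra.
Qed.

Lemma cyc_Xeq : cyc (@Xeq R T).
Proof.
split=> [i j ij|i j]; first by rewrite ler_nat.
by rewrite /Xeq -natrD ler_nat; have := ltn_ord j; lia.
Qed.

(* Up to normalisation, the number of translates [xe X j + m T], [m] an integer, lying in [(-oo, x]]. *)
Definition acnt X x j : int := Num.floor ((x - xe X j) / T%:R).

(* The number of points in [(x, x + z]] (minus the number in [(x + z, x]] if [z < 0]). *)
Definition cnt X x z : int := \sum_(i < T) (acnt X (x + z) (i : nat) - acnt X x (i : nat)).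

Lemma u_of_cnt X x z : u_of X x - u_of X (x + z) = (cnt X x z)%:~R - z.
Proof.
rewrite /u_of /cnt rmorph_sum/=.
under [in RHS]eq_bigr do rewrite rmorphB/= /acnt !xe_ord.
rewrite sumrB; lra.
Qed.

Lemma acntDT X x j k : acnt X x (j + k * T%:Z) = acnt X x j - k.
Proof.
rewrite /acnt xeDT -(@intrKfloor R k) -floorN ?intr_int//.
rewrite -floorDrz ?rpredN ?intr_int// intrKfloor.
congr Num.floor; have : T%:R != 0 :> R by rewrite pnatr_eq0.
by move: (T%:R : R) => t t0; field.
Qed.

Lemma acnt_le X x y j : x <= y -> acnt X x j <= acnt X y j.
Proof.
by move=> xy; apply: le_floor; rewrite ler_wpM2r ?invr_ge0// lerD2r.
Qed.

Lemma acnt_anti X x j k : cyc X -> j <= k -> acnt X x k <= acnt X x j.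
Proof.
move=> cX jk; apply: le_floor; rewrite ler_wpM2r ?invr_ge0// lerD2l lerN2.
exact: xe_homo.
Qed.

(** Moving the window by one replaces its first term by that term plus [c]. This serves both [acnt],
    where [c] is -1, and [xe], where [c] is [T]. *)
Lemma sum_shift (V : zmodType) (f : int -> V) (c : V) (k : int) :
  (forall j, f (j + T%:Z) = f j + c) ->
  \sum_(i < T) f ((i : nat)%:Z + k) = \sum_(i < T) f (i : nat)%:Z + c *~ k.
Proof.
move=> fT.
have S j : \sum_(i < T) f ((i : nat)%:Z + (j + 1)) = \sum_(i < T) f ((i : nat)%:Z + j) + c.
  rewrite big_ord_recr big_ord_recl/=.
  have -> : f (n%:Z + (j + 1)) = f (0%:Z + j) + c.
    by rewrite -fT; congr f; lia.
  rewrite (eq_bigr (fun i : 'I_n => f ((bump 0 i)%:Z + j))); last first.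
    by move=> i _; congr f; rewrite /bump/=; lia.
  by rewrite addrA [f _ + _]addrC.
elim: k => [|k IH|k IH].
- by rewrite mulr0z addr0; apply: eq_bigr => i _; rewrite addr0.
- have -> : k.+1%:Z = k%:Z + 1 by lia.
  by rewrite S IH mulrzDr mulr1z addrA.
- have := S (- k.+1%:Z); have -> : - k.+1%:Z + 1 = - k%:Z by lia.
  rewrite IH => e; apply: (addIr c); rewrite -e.
  have -> : - k%:Z = - k.+1%:Z + 1 by lia.
  by rewrite mulrzDr mulr1z addrA.
Qed.

Lemma sum_max_same_sign (I : finType) (f : I -> int) :
  (forall a : I, 0 <= f a) \/ (forall a : I, f a <= 0) ->
  Num.max (\sum_a f a) 0 = \sum_a Num.max (f a) 0.
Proof.
move=> [] h.
  rewrite max_l; last exact: sumr_ge0.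
  by apply: eq_bigr => i _; rewrite max_l.
rewrite max_r; last exact: sumr_le0.
by rewrite big1// => i _; rewrite max_r.
Qed.

(* Summing the positive parts over residue classes loses nothing, because the summands all have the same sign by monotonicity in the index. *)
Lemma cnt_pos X x z k : cyc X ->
  Num.max (cnt X x z - k) 0 =
  \sum_(i < T) Num.max (acnt X (x + z) ((i : nat)%:Z + k) - acnt X x (i : nat)%:Z) 0.
Proof.
move=> cX.
have -> : cnt X x z - k =
    \sum_(i < T) (acnt X (x + z) ((i : nat)%:Z + k) - acnt X x (i : nat)%:Z).
  rewrite sumrB (@sum_shift _ _ (-1)).
    by rewrite /cnt sumrB mulNrz intz addrAC.
  by move=> j; rewrite -{1}(mul1r T%:Z) acntDT.
apply: sum_max_same_sign.
(* A positive summand is an integer, hence at least 1, and passing to any other index loses at most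
   1, the cost of one period; so no summand is negative. *)
have [/existsP[i hi]|] := boolP [exists i : 'I_T,
    acnt X (x + z) ((i : nat)%:Z + k) - acnt X x (i : nat)%:Z > 0]; last first.
  by rewrite negb_exists => /forallP h; right => i; move: (h i); rewrite -leNgt.
left => i'.
have [ii'|ii'] := leqP i i'.
  have h1 : acnt X (x + z) ((i : nat)%:Z + T%:Z + k) <= acnt X (x + z) ((i' : nat)%:Z + k).
    by apply: acnt_anti => //; have := ltn_ord i'; lia.
  have h2 : acnt X x i' <= acnt X x i by apply: acnt_anti.
  move: h1; have -> : (i : nat)%:Z + T%:Z + k = (i : nat)%:Z + k + 1 * T%:Z by lia.
  rewrite acntDT; lia.
have h1 : acnt X (x + z) ((i : nat)%:Z + k) <= acnt X (x + z) ((i' : nat)%:Z + k).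
  by apply: acnt_anti => //; lia.
have h2 : acnt X x ((i' : nat)%:Z + 1 * T%:Z) <= acnt X x i.
  by apply: acnt_anti => //; have := ltn_ord i; lia.
move: h2; rewrite acntDT; lia.
Qed.

(** Each of the [T] summands is a difference of floors of two numbers [z / T] apart, hence strictly
    within 1 of [z / T]. *)
Lemma cnt_bound X x z : z - T%:R < (cnt X x z)%:~R < z + T%:R.
Proof.
have h i : z / T%:R - 1 < (acnt X (x + z) (i : nat) - acnt X x (i : nat))%:~R < z / T%:R + 1.
  rewrite intrB /acnt; set a := xe _ _.
  have := floor_itv ((x + z - a) / T%:R); have := floor_itv ((x - a) / T%:R).
  have -> : (x + z - a) / T%:R = (x - a) / T%:R + z / T%:R by ring.
  move: ((x - a) / T%:R) (z / T%:R) => b c.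
  by rewrite !intrD !mulr1z => /andP[h1 h2] /andP[h3 h4]; apply/andP; split; lra.
have e c : \sum_(i < T) (z / T%:R + c) = z + c *+ T.
  rewrite sumr_const card_ord mulrnDl; congr (_ + _).
  by rewrite -(mulr_natr (z / T%:R) T) divfK// pnatr_eq0.
rewrite /cnt raddf_sum/=; apply/andP; split.
  rewrite -mulNrn -e; apply: ltr_sum; first by rewrite /index_enum -enumT has_predT size_enum_ord.
  by move=> i _; case/andP: (h i).
rewrite -[T%:R]/(1 *+ T) -e; apply: ltr_sum; first by rewrite /index_enum -enumT has_predT size_enum_ord.
by move=> i _; case/andP: (h i).
Qed.

Lemma cnt_ge0 X x z : 0 <= z -> 0 <= cnt X x z.
Proof.
by move=> z0; apply: sumr_ge0 => i _; rewrite subr_ge0; apply: acnt_le; lra.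
Qed.

Lemma cnt_le0 X x z : z <= 0 -> cnt X x z <= 0.
Proof.
by move=> z0; apply: sumr_le0 => i _; rewrite subr_le0; apply: acnt_le; lra.
Qed.

End Combinatorics.

(** * Second differences and a discrete Taylor formula *)

Section DiscreteConvexity.
Variable R : realType.
Implicit Types (phi : int -> R) (k N : int).

Definition D2 phi k : R := phi (k + 1) - 2 * phi k + phi (k - 1).

(** A function on the integers is its chord line through [k0] and [k0 + 1] plus, at each later node,
    a hinge whose coefficient is the change of slope there. Hinges at nodes not below [N] vanish, so
    one range of nodes serves all the [N] allowed. *)
Lemma discrete_taylor phi (k0 : int) (M : nat) N : k0 <= N <= k0 + M%:Z + 1 ->
  phi N = phi k0 + (N - k0)%:~R * (phi (k0 + 1) - phi k0)
    + \sum_(m < M) D2 phi (k0 + 1 + (m : nat)%:Z)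
        * (Num.max (N - (k0 + 1 + (m : nat)%:Z)) 0)%:~R.
Proof.
move=> /andP[h1 h2].
have [d Nd] : exists d : nat, N = k0 + d%:Z by exists `|N - k0|%N; lia.
have {h1 h2} : (d <= M.+1)%N by lia.
rewrite {}Nd.
(* Only the [e.-1] nodes strictly between [k0] and [k0 + e] matter; the sum is padded with zero
   terms to length [M] afterwards. *)
have E (e : nat) : phi (k0 + e%:Z) = phi k0 + (e%:Z)%:~R * (phi (k0 + 1) - phi k0)
    + \sum_(m < e.-1) D2 phi (k0 + 1 + (m : nat)%:Z)
        * ((e - m.+1)%N%:Z)%:~R.
  elim: e => [|[|e] IH].
  - by rewrite big_ord0 !addr0 mul0r addr0.
  - by rewrite big_ord0 addr0 mul1r; ring.
  (* The increment after [e.+1] is the first one plus the second differences met so far. *)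
  - have -> : phi (k0 + e.+2%:Z) = phi (k0 + e.+1%:Z) +
        (phi (k0 + 1) - phi k0) + \sum_(m < e.+1) D2 phi (k0 + 1 + (m : nat)%:Z).
      move: (e.+1) => f; clear; elim: f => [|f IH].
        by rewrite big_ord0 !addr0; ring.
      rewrite big_ord_recr/=.
      have -> : phi (k0 + f.+1%:Z) + (phi (k0 + 1) - phi k0) +
          (\sum_(m < f) D2 phi (k0 + 1 + (m : nat)%:Z) + D2 phi (k0 + 1 + f%:Z)) =
          (phi (k0 + f%:Z) + (phi (k0 + 1) - phi k0) + \sum_(m < f) D2 phi (k0 + 1 + (m : nat)%:Z)) +
          (phi (k0 + f.+1%:Z) - phi (k0 + f%:Z) + D2 phi (k0 + 1 + f%:Z)) by ring.
      rewrite -IH /D2.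
      have -> : k0 + 1 + f%:Z + 1 = k0 + f.+2%:Z by lia.
      have -> : k0 + 1 + f%:Z - 1 = k0 + f%:Z by lia.
      have -> : k0 + 1 + f%:Z = k0 + f.+1%:Z by lia.
      ring.
    rewrite IH/= big_ord_recr/= [in RHS]big_ord_recr/= subSnn.
    have -> : \sum_(i < e) D2 phi (k0 + 1 + (i : nat)%:Z) * ((e.+2 - i.+1)%N%:Z)%:~R =
       \sum_(i < e) D2 phi (k0 + 1 + (i : nat)%:Z) * ((e.+1 - i.+1)%N%:Z)%:~R
       + \sum_(i < e) D2 phi (k0 + 1 + (i : nat)%:Z).
      rewrite -big_split/=; apply: eq_bigr => i _.
      have -> : (e.+2 - i.+1)%N%:Z = (e.+1 - i.+1)%N%:Z + 1 by have := ltn_ord i; lia.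
      rewrite intrD; ring.
    rewrite -[e.+2]addn1 PoszD intrD; ring.
case: d => [|d] dM.
  rewrite !addr0 subrr mul0r addr0 big1 ?addr0// => m _.
  by rewrite max_r ?mulr0//; lia.
have -> : k0 + d.+1%:Z - k0 = d.+1%:Z by lia.
rewrite E; congr (_ + _).
rewrite (big_ord_widen_cond M xpredT (fun m => D2 phi (k0 + 1 + m%:Z) * ((d.+1 - m.+1)%N%:Z)%:~R))//=.
rewrite big_mkcond/=; apply: eq_bigr => m _; case: ifP => md.
  by congr (_ * _%:~R); rewrite max_l; lia.
by rewrite max_r ?mulr0//; lia.
Qed.

End DiscreteConvexity.

(** * The energy at a fixed increment *)

Section IntegralOverPeriod.
Local Open Scope classical_set_scope.
Variables (R : realType) (n : nat).
Local Notation T := n.+1.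
Implicit Types (f g : R -> R).

Let mu := @lebesgue_measure R.
Let D : set R := `[0%R, T%:R].

(** Integrability travels with the value, so that linear combinations are integrated without further
    side conditions. *)
Definition has_integral f (v : R) : Prop :=
  mu.-integrable D (EFin \o f) /\ (\int[mu]_(x in D) (f x)%:E)%E = v%:E.

Let mD : measurable (D : set (measurableTypeR R)). Proof. exact: measurable_itv. Qed.

Lemma has_integral_ext f g v : (forall x, 0 <= x <= T%:R -> f x = g x) ->
  has_integral f v -> has_integral g v.
Proof.
move=> fg [If Ef]; have fg' x : x \in D -> (f x)%:E = (g x)%:E.
  by rewrite inE /D/= in_itv/= => /fg ->.
split; first by apply: eq_integrable If.
by rewrite -Ef; apply: eq_integral => x /fg' ->.
Qed.

Lemma has_integralD f g a b : has_integral f a -> has_integral g b ->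
  has_integral (fun x => f x + g x) (a + b).
Proof.
move=> [If Ef] [Ig Eg]; split.
  by have := integrableD mD If Ig; apply: eq_integrable => // x _.
by have := integralD_EFin mD If Ig; rewrite Ef Eg.
Qed.

Lemma has_integralZ c f a : has_integral f a ->
  has_integral (fun x => c * f x) (c * a).
Proof.
move=> [If Ef]; split.
  by have := integrableZl mD c If; apply: eq_integrable => // x _.
by have := integralZl mD If c; rewrite Ef.
Qed.

Lemma has_integral_indic r : 0 <= r <= T%:R ->
  has_integral (\1_(`[T%:R - r, T%:R] : set R)) r.
Proof.
move=> /andP[r0 rT]; split.
  apply: (@integrableS _ _ _ mu setT) => //.
  exact: integrable_indic_itv.
rewrite integral_indic//= (_ : _ `&` _ = `[T%:R - r, T%:R]).
  rewrite /mu lebesgue_measure_itv/= lte_fin.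
  case: ltP => h; first by rewrite -EFinB; congr (_%:E); lra.
  by congr (_%:E); lra.
by apply/seteqP; split => x /=; rewrite /D/= !in_itv/=; [case|]; move=> /andP[h1 h2];
  rewrite ?h1 ?h2//; split; rewrite ?h1 ?h2//; lra.
Qed.

Lemma has_integral_cst c : has_integral (fun=> c) (c * T%:R).
Proof.
apply: (@has_integral_ext (fun x => c * \1_(`[T%:R - T%:R, T%:R] : set R) x)).
  by move=> x xT; rewrite indicE mem_set ?mulr1//= in_itv/= subrr.
by apply/has_integralZ/has_integral_indic; rewrite lexx ler0n.
Qed.

Lemma has_integral_sum (I : Type) (r : seq I) (F : I -> R -> R) (v : I -> R) :
  (forall i, has_integral (F i) (v i)) ->
  has_integral (fun x => \sum_(i <- r) F i x) (\sum_(i <- r) v i).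
Proof.
move=> h; elim: r => [|i r IH].
  apply: (@has_integral_ext (fun=> 0)); first by move=> x _; rewrite big_nil.
  by have := has_integral_cst 0; rewrite big_nil mul0r.
apply: (@has_integral_ext (fun x => F i x + \sum_(i <- r) F i x)).
  by move=> x _; rewrite big_cons.
by rewrite big_cons; apply: has_integralD.
Qed.

(* With [c = q T + r] and [0 <= r < T], the integrand is [q] plus the indicator of [[T - r, T]]. *)
Lemma has_integral_floor c :
  has_integral (fun x => (Num.floor ((x + c) / T%:R))%:~R) c.
Proof.
have T0 : 0 < T%:R :> R by rewrite ltr0n.
set q := Num.floor (c / T%:R); set r := c - q%:~R * T%:R.
have /andP[q1 q2] := floor_itv (c / T%:R).
have r0 : 0 <= r by move: q1; rewrite ler_pdivlMr// /r; lra.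
have rT : r < T%:R.
  by move: q2; rewrite ltr_pdivrMr// intrD mulr1z mulrDl /r; lra.
apply: (@has_integral_ext (fun x => q%:~R + \1_(`[T%:R - r, T%:R] : set R) x)).
  move=> x /andP[x0 xT]; rewrite indicE.
  have -> : (x + c) / T%:R = (x + r) / T%:R + q%:~R.
    by rewrite /r; have := gt_eqF T0 => /negbT; move: (T%:R : R) => t t0; field.
  rewrite floorDrz ?intr_int// intrKfloor intrD addrC; congr (_ + _).
  have [h|h] := leP (T%:R - r) x.
    rewrite mem_set; last by rewrite /= in_itv/= h xT.
    rewrite (@floor_def _ _ 1)//; apply/andP; split.
      by rewrite ler_pdivlMr// mulr1z mul1r; lra.
    by rewrite ltr_pdivrMr// intrD mulr1z mulrDl mul1r; lra.
  rewrite memNset; last by rewrite /= in_itv/= => /andP[]; lra.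
  rewrite (@floor_def _ _ 0)//; apply/andP; split.
    by rewrite ler_pdivlMr// mul0r; lra.
  by rewrite ltr_pdivrMr// add0r mulr1z mul1r; lra.
have -> : c = q%:~R * T%:R + r by rewrite /r; ring.
apply: has_integralD; first exact: has_integral_cst.
by apply: has_integral_indic; rewrite r0 ltW.
Qed.

Lemma has_integral_floor_diff a b :
  has_integral (fun x => (Num.floor ((x + a) / T%:R) - Num.floor ((x + b) / T%:R))%:~R) (a - b).
Proof.
apply: (@has_integral_ext (fun x => (Num.floor ((x + a) / T%:R))%:~R + (-1) * (Num.floor ((x + b) / T%:R))%:~R)).
  by move=> x _; rewrite intrB; ring.
rewrite -[- b]mulN1r; apply: has_integralD; first exact: has_integral_floor.
by apply: has_integralZ; apply: has_integral_floor.
Qed.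

(** Since floor is monotone, the difference has the same sign for all [x]: its positive part is the
    difference itself or zero. *)
Lemma has_integral_floor_pos a b :
  has_integral (fun x => (Num.max (Num.floor ((x + a) / T%:R) - Num.floor ((x + b) / T%:R)) 0)%:~R)
    (Num.max (a - b) 0).
Proof.
have T0 : 0 < (T%:R)^-1 :> R by rewrite invr_gt0 ltr0n.
have [ab|/ltW ab] := leP b a.
  rewrite max_l ?subr_ge0//; apply: has_integral_ext (has_integral_floor_diff a b) => x _.
  by rewrite max_l// subr_ge0; apply: le_floor; rewrite ler_pM2r//; lra.
rewrite max_r ?subr_le0//.
have := has_integral_cst 0; rewrite mul0r; apply: has_integral_ext => x _.
by rewrite max_r// subr_le0; apply: le_floor; rewrite ler_pM2r//; lra.
Qed.

Lemma has_integral_acnt_pos (X : 'I_T -> R) z j k :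
  has_integral (fun x => (Num.max (acnt X (x + z) k - acnt X x j) 0)%:~R)
    (Num.max (z - (xe X k - xe X j)) 0).
Proof.
have -> : z - (xe X k - xe X j) = (z - xe X k) - (- xe X j) by ring.
apply: has_integral_ext (has_integral_floor_pos _ _) => x _.
by rewrite /acnt addrA.
Qed.

(** The mean does not see [X], so the affine part of the Taylor expansion cancels when two
    configurations are compared. *)
Lemma has_integral_cnt (X : 'I_T -> R) z :
  has_integral (fun x => (cnt X x z)%:~R) (z * T%:R).
Proof.
have -> : z * T%:R = \sum_(i < T) z by rewrite sumr_const card_ord mulr_natr.
apply: (@has_integral_ext (fun x => \sum_(i < T) (acnt X (x + z) (i : nat) - acnt X x (i : nat))%:~R)).
  by move=> x _; rewrite /cnt rmorph_sum.
apply: has_integral_sum => i.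
have -> : z = (z - xe X (i : nat)) - (- xe X (i : nat)) by ring.
apply: has_integral_ext (has_integral_floor_diff _ _) => x _.
by rewrite /acnt addrA; congr (_%:~R); congr (Num.floor _ - _); ring.
Qed.

Definition phi (p z : R) (k : int) : R := `|k%:~R - z| `^ p.

(* A lower bound for [cnt X x z] independent of [X] and [x]; see [cnt_range]. *)
Definition bot (z : R) : int := Num.floor z - T%:Z - 1.

(* The closed form of the integral over [x] in [[0, T]] of [|u (x) - u (x + z)| ^ p], see [has_integral_energy]. Only the last sum depends on [X]. *)
Definition energy (p : R) (X : 'I_T -> R) (z : R) : R :=
  phi p z (bot z) * T%:R
  + (z - (bot z)%:~R) * T%:R * (phi p z (bot z + 1) - phi p z (bot z))
  + \sum_(m < T.*2.+2) D2 (phi p z) (bot z + 1 + (m : nat)%:Z) *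
      \sum_(i < T) Num.max (z - (xe X ((i : nat)%:Z + (bot z + 1 + (m : nat)%:Z)) - xe X (i : nat))) 0.

(** By [cnt_bound] the count varies within a window that depends on [z] and [T] only; integrating
    the Taylor formula term by term requires nodes independent of [x]. *)
Lemma cnt_range (X : 'I_T -> R) x z :
  bot z <= cnt X x z <= bot z + (T.*2.+2)%:Z + 1.
Proof.
have /andP[h1 h2] := cnt_bound X x z; have /andP[z1 z2] := floor_itv z.
have h3 : (Num.floor z - T%:Z)%:~R < (cnt X x z)%:~R :> R.
  by rewrite intrB -[(T%:Z)%:~R]/(T%:R); lra.
have h4 : (cnt X x z)%:~R < (Num.floor z + 1 + T%:Z)%:~R :> R.
  by move: z2; rewrite !intrD -[(T%:Z)%:~R]/(T%:R); lra.
by move: h3 h4; rewrite !ltr_int /bot; lia.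
Qed.

(** [discrete_taylor] is applied at [cnt X x z]; [cnt_pos] splits every hinge into positive parts of
    floor differences, whose integrals are explicit. *)
Lemma has_integral_energy (p : R) (X : 'I_T -> R) z : cyc X ->
  has_integral (fun x => `|u_of X x - u_of X (x + z)| `^ p) (energy p X z).
Proof.
move=> cX; apply: (@has_integral_ext (fun x =>
    phi p z (bot z)
    + (phi p z (bot z + 1) - phi p z (bot z)) * ((cnt X x z)%:~R + - (bot z)%:~R)
    + \sum_(m < T.*2.+2) D2 (phi p z) (bot z + 1 + (m : nat)%:Z) *
        \sum_(i < T) (Num.max (acnt X (x + z) ((i : nat)%:Z + (bot z + 1 + (m : nat)%:Z)) - acnt X x (i : nat)) 0)%:~R)).
  move=> x _; rewrite u_of_cnt -/(phi p z (cnt X x z)).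
  rewrite (discrete_taylor (phi p z) (cnt_range X x z)); congr (_ + _ + _).
    by rewrite intrB mulrC.
  apply: eq_bigr => m _; congr (_ * _).
  by rewrite cnt_pos// rmorph_sum.
apply: has_integralD; first apply: has_integralD.
- exact: has_integral_cst.
- have -> : (z - (bot z)%:~R) * T%:R * (phi p z (bot z + 1) - phi p z (bot z)) =
      (phi p z (bot z + 1) - phi p z (bot z)) * (z * T%:R + - (bot z)%:~R * T%:R) by ring.
  apply: has_integralZ; apply: has_integralD.
    exact: has_integral_cnt.
  exact: has_integral_cst.
- apply: has_integral_sum => m; apply: has_integralZ; apply: has_integral_sum => i.
  exact: has_integral_acnt_pos.
Qed.

End IntegralOverPeriod.

(** * Convexity in the positions and comparison with the lattice, for a fixed increment *)

Section EnergyInequalities.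
Variables (R : realType) (n : nat) (p : R).
Hypothesis p1 : 1 <= p.
Local Notation T := n.+1.
Implicit Types (X Y : 'I_T -> R) (z : R) (k : int).

Let p0 : 0 <= p. Proof. exact: le_trans p1. Qed.

(** Triangle inequality, then convexity of the [p]-th power on the nonnegative reals. *)
Lemma norm_powR_midpoint (a b : R) :
  2 * `|(a + b) / 2| `^ p <= `|a| `^ p + `|b| `^ p.
Proof.
have h2 : 0 <= (2^-1 : R) <= 1 by apply/andP; split; lra.
have := @convex_powR R p p1 (Itv01 (andP h2).1 (andP h2).2) `|a| `|b|.
rewrite !inE/= !in_itv/= !normr_ge0 => /(_ isT isT).
have half : 1 - 2^-1 = 2^-1 :> R by field.
set c := (X in X `^ p <= _); set d := (X in _ <= X).
have -> : c = 2^-1 * `|a| + (1 - 2^-1) * `|b| by [].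
have -> : d = 2^-1 * `|a| `^ p + (1 - 2^-1) * `|b| `^ p by [].
rewrite half -!mulrDr => h.
have h3 : `|(a + b) / 2| `^ p <= (2^-1 * (`|a| + `|b|)) `^ p.
  apply: ge0_ler_powR => //; rewrite ?nnegrE ?normr_ge0// ?mulr_ge0 ?addr_ge0 ?invr_ge0//.
  by rewrite normrM mulrC ger0_norm ?invr_ge0// ler_wpM2l ?invr_ge0// ler_normD.
lra.
Qed.

Lemma D2_phi_ge0 z k : 0 <= D2 (phi p z) k.
Proof.
rewrite /D2 /phi; have := norm_powR_midpoint ((k + 1)%:~R - z) ((k - 1)%:~R - z).
have -> : ((k + 1)%:~R - z + ((k - 1)%:~R - z)) / 2 = k%:~R - z :> R.
  by rewrite !intrD; field.
lra.
Qed.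

(** The outer arguments [2 - z] and [z] have midpoint 1, so their powers add up to at least 2, while
    the power of [1 - z] is below 1. Strictness holds even for [p = 1], because the kink at [z] lies
    between the outer nodes 0 and 2. *)
Lemma D2_phi1_gt0 z : 0 < z < 1 -> 0 < D2 (phi p z) 1.
Proof.
move=> /andP[z0 z1]; rewrite /D2 /phi.
have := norm_powR_midpoint ((1 + 1)%:~R - z) z.
have -> : ((1 + 1)%:~R - z + z) / 2 = 1 :> R by rewrite subrK intrD mulr1z; field.
rewrite normr1 powR1 subrr mulr0z sub0r normrN mulr1z.
have : `|1 - z| `^ p < 1.
  have e1 : 1 `^ p = 1 :> R by rewrite powR1.
  rewrite -[ltRHS]e1; apply: gt0_ltr_powR; rewrite ?nnegrE ?normr_ge0 ?ler01//.
    exact: lt_le_trans p1.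
  by rewrite ger0_norm; lra.
lra.
Qed.

(** The two outer arguments have modulus at most 2, and the middle term is subtracted. *)
Lemma D2_phi_le z k : `|z - k%:~R| <= 1 -> D2 (phi p z) k <= 2 * 2 `^ p.
Proof.
move=> zk; rewrite /D2 /phi.
have h (e : R) : `|e| <= 2 -> `|e| `^ p <= 2 `^ p.
  by move=> e2; apply: ge0_ler_powR; rewrite ?nnegrE ?normr_ge0.
have h1 : `|(k + 1)%:~R - z| <= 2.
  rewrite intrD mulr1z; move: zk; rewrite !ler_norml => /andP[? ?]; apply/andP; split; lra.
have h2 : `|(k - 1)%:~R - z| <= 2.
  rewrite intrB mulr1z; move: zk; rewrite !ler_norml => /andP[? ?]; apply/andP; split; lra.
have := h _ h1; have := h _ h2; have := powR_ge0 `|k%:~R - z| p; lra.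
Qed.

Lemma max0_le_convex (m : nat) (l a : 'I_m -> R) : (forall b, 0 <= l b) ->
  Num.max (\sum_b l b * a b) 0 <= \sum_b l b * Num.max (a b) 0.
Proof.
move=> l0; rewrite ge_max; apply/andP; split.
  by apply: ler_sum => b _; apply: ler_wpM2l => //; rewrite le_max lexx.
by apply: sumr_ge0 => b _; apply: mulr_ge0 => //; rewrite le_max lexx orbT.
Qed.

(** The configuration enters only through hinges of differences of [xe], which are affine in the
    positions; hinges are convex and their coefficients [D2] are nonnegative. *)
Lemma energy_convex (m : nat) (l : 'I_m -> R) (Y : 'I_m -> 'I_T -> R) z :
  (forall a, 0 <= l a) -> \sum_a l a = 1 ->
  energy p (fun i => \sum_a l a * Y a i) z <= \sum_a l a * energy p (Y a) z.
Proof.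
move=> l0 l1; rewrite /energy.
under [leRHS]eq_bigr do rewrite mulrDr.
rewrite big_split/= -mulr_suml l1 mul1r lerD2l.
under [leRHS]eq_bigr do rewrite mulr_sumr.
rewrite exchange_big/=; apply: ler_sum => q _.
under [leRHS]eq_bigr do rewrite mulrCA.
rewrite -mulr_sumr; apply: ler_wpM2l; first exact: D2_phi_ge0.
under [leRHS]eq_bigr do rewrite mulr_sumr.
rewrite exchange_big/=; apply: ler_sum => i _.
rewrite !xe_affine//.
have -> : forall u v : 'I_m -> R, z - (\sum_a l a * u a - \sum_a l a * v a) =
    \sum_a l a * (z - (u a - v a)).
  move=> u v; rewrite -sumrB -[z in LHS]mul1r -l1 mulr_suml -sumrB.
  by apply: eq_bigr => a _; ring.
exact: max0_le_convex.
Qed.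

(** The remainder at [t = d] of the convex function sending [t] to [(z - t)_+] over its supporting
    line at [t = c], whose slope is -1 if [c < z] and 0 otherwise. *)
Definition excess (z d c : R) : R :=
  Num.max (z - d) 0 - Num.max (z - c) 0 + (if c < z then d - c else 0).

Lemma excess_ge0 z d c : 0 <= excess z d c.
Proof.
rewrite /excess; have m1 : z - d <= Num.max (z - d) 0 by rewrite le_max lexx.
have m2 : 0 <= Num.max (z - d) 0 by rewrite le_max lexx orbT.
move: (Num.max (z - d) 0) m1 m2 => m m1 m2.
case: ifP => [h|/negbT]; first by rewrite max_l; lra.
by rewrite -leNgt => h; rewrite max_r; lra.
Qed.

Lemma excess_gt0 z d c : d < z < c -> 0 < excess z d c.
Proof.
move=> /andP[dz zc]; rewrite /excess ifF; last by apply/negbTE; rewrite -leNgt ltW.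
rewrite [Num.max (z - c) 0]max_r; last lra.
by rewrite max_l; lra.
Qed.

(** The hinge is affine on either side of [z], so the remainder vanishes unless [z] separates [c]
    and [d] or equals one of them; it never exceeds their distance. *)
Lemma excess_le z d c : excess z d c <= if `|z - c| <= `|d - c| then `|d - c| else 0.
Proof.
have d1 : d - c <= `|d - c| by exact: ler_norm.
have d2 : c - d <= `|d - c| by rewrite distrC; exact: ler_norm.
rewrite /excess; case: (ifP (c < z)) => [cz|/negbT]; last rewrite -leNgt => cz.
  have zc : 0 < z - c by lra.
  rewrite [Num.max (z - c) 0]max_l ?(ltW zc)// (gtr0_norm zc).
  move: `|d - c| d1 d2 => e d1 d2; case: ifP => [_|/negbT]; last rewrite -ltNge => h.
    by case: (leP (z - d) 0) => h; lra.
  by rewrite max_l; lra.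
have zc : z - c <= 0 by lra.
rewrite [Num.max (z - c) 0]max_r// (ler0_norm zc).
move: `|d - c| d1 d2 => e d1 d2; case: ifP => [_|/negbT]; last rewrite -ltNge => h.
  by case: (leP (z - d) 0) => h; lra.
by rewrite max_r; lra.
Qed.

Definition level z (m : nat) : int := bot n z + 1 + m%:Z.

(* For each [k] the increments [xe X (i + k) - xe X i], [i < T], add up to [k T], so the linear part of [excess] cancels. *)
Lemma energy_sub_Xeq X z :
  energy p X z - energy p (@Xeq R T) z =
  \sum_(m < T.*2.+2) D2 (phi p z) (level z m) *
    \sum_(i < T) excess z (xe X ((i : nat)%:Z + level z m) - xe X (i : nat)) (level z m)%:~R.
Proof.
rewrite /energy opprD addrACA subrr add0r -sumrB; apply: eq_bigr => m _.
rewrite -mulrBr -sumrB -/(level z m); congr (_ * _).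
move: (level z m) => k; rewrite /excess [in RHS]big_split/=.
rewrite [X in _ = _ + X](_ : _ = 0) ?addr0.
  apply: eq_bigr => i _; rewrite !xe_Xeq intrD; congr (_ - Num.max (z - _) _); ring.
case: ltP => _; last by rewrite big1.
rewrite sumrB sumrB (@sum_shift _ _ (xe X) T%:R); last first.
  by move=> j; rewrite -[T%:Z in LHS]mul1r xeDT mul1r.
rewrite sumr_const card_ord -[T%:R *~ k]mulrzl -[k%:~R *+ T]mulr_natr; ring.
Qed.

Lemma energy_Xeq_le X z : energy p (@Xeq R T) z <= energy p X z.
Proof.
rewrite -subr_ge0 energy_sub_Xeq; apply: sumr_ge0 => m _.
by rewrite mulr_ge0 ?D2_phi_ge0// sumr_ge0// => i _; apply: excess_ge0.
Qed.

(** One term is strictly positive, that of node 1 and point [i]: the gap lies below [z] and the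
    lattice gap 1 above it. *)
Lemma energy_Xeq_lt X z (i : 'I_T) : 0 < z < 1 ->
  xe X ((i : nat)%:Z + 1) - xe X (i : nat) < z ->
  energy p (@Xeq R T) z < energy p X z.
Proof.
move=> z01 gap; rewrite -subr_gt0 energy_sub_Xeq.
(* Here [Num.floor z] is 0, so [bot] is [- T - 1] and the node 1 has number [T + 1]. *)
have lT : (T.+1 < T.*2.+2)%N by lia.
have lE : level z (Ordinal lT) = 1.
  rewrite /level /bot (@floor_def _ z 0); first by move=> /=; lia.
  by case/andP: z01 => ? ?; rewrite add0r mulr1z mulr0z; apply/andP; split; lra.
rewrite (bigD1 (Ordinal lT))//= lE (bigD1 i)//=.
have := D2_phi1_gt0 z01; case/andP: z01 => z0 z1 D20.
apply: ltr_pwDl; last first.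
  apply: sumr_ge0 => m _.
  by rewrite mulr_ge0 ?D2_phi_ge0// sumr_ge0// => ? _; apply: excess_ge0.
rewrite mulr_gt0//; apply: ltr_pwDl; last by apply: sumr_ge0 => ? _; apply: excess_ge0.
by apply: excess_gt0; rewrite gap mulr1z.
Qed.

Lemma xe_perturb X (i : 'I_T) h (j : int) :
  xe (perturb X i h) j = xe X j + (if inord `|(j %% T)%Z|%N == i then h else 0).
Proof.
by rewrite /xe /perturb; case: ifP => _; rewrite ?addr0// addrAC.
Qed.

(** Moving one point changes each difference of [xe] by at most [|h|], so by [excess_le] only nodes
    within [|h|] of [z] contribute, at most [|h|] per point. At node 0 the difference stays 0, and
    leaving 0 out keeps the singularity of the weight away. The constant counts nodes, points and
    the bound on [D2]. *)
Lemma energy_perturb_Xeq (i : 'I_T) h z : `|h| <= 1 ->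
  energy p (perturb (@Xeq R T) i h) z - energy p (@Xeq R T) z <=
  if `[< exists2 k : int, k != 0 & `|z - k%:~R| <= `|h| >]
  then (T.*2.+2 * T)%:R * (2 * 2 `^ p) * `|h| else 0.
Proof.
move=> h1; rewrite energy_sub_Xeq; set X := perturb _ _ _.
have C0 : 0 <= 2 * 2 `^ p :> R by rewrite mulr_ge0// powR_ge0.
have ex_le m (j : 'I_T) : let k := level z m in
    excess z (xe X ((j : nat)%:Z + k) - xe X (j : nat)) k%:~R <=
    if (k != 0) && (`|z - k%:~R| <= `|h|) then `|h| else 0.
  move=> k; have [->|k0] := eqVneq k 0.
    by rewrite addr0 subrr (le_trans (excess_le _ _ _))//= subrr normr0; case: ifP.
  apply: (le_trans (excess_le _ _ _)).
  have : `|xe X ((j : nat)%:Z + k) - xe X (j : nat) - k%:~R| <= `|h|.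
    rewrite /X !xe_perturb !xe_Xeq intrD.
    set a := if _ then h else 0; set b := if _ then h else 0.
    have -> : (j : nat)%:~R + k%:~R + a - ((j : nat)%:~R + b) - k%:~R = a - b :> R by ring.
    by rewrite /a /b; case: ifP; case: ifP => _ _;
      rewrite ?subrr ?subr0 ?sub0r ?normrN ?normr0.
  move: (`|_ - k%:~R|) => d dh /=; case: ifPn => zd; last by case: ifP.
  by rewrite (le_trans zd dh).
case: asboolP => [_|nz].
  have -> : (T.*2.+2 * T)%:R * (2 * 2 `^ p) * `|h| =
      \sum_(m < T.*2.+2) (2 * 2 `^ p) * \sum_(j < T) `|h|.
    rewrite !sumr_const !card_ord -[X in _ = X]mulr_natr -(mulr_natr `|h| T) natrM.
    by move: (T.*2.+2%:R : R) (T%:R : R) => u v; ring.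
  apply: ler_sum => m _.
  have [zk|zk] := leP `|z - (level z m)%:~R| `|h|.
    apply: ler_pM.
    - exact: D2_phi_ge0.
    - by apply: sumr_ge0 => *; apply: excess_ge0.
    - by apply: D2_phi_le; apply: le_trans zk h1.
    - apply: ler_sum => j _; apply: (le_trans (ex_le m j)) => /=.
      by case: ifP.
  rewrite [leLHS](_ : _ = 0); first by rewrite mulr_ge0// sumr_ge0.
  rewrite big1 ?mulr0// => j _; apply/eqP; rewrite eq_le excess_ge0 andbT.
  apply: (le_trans (ex_le m j)) => /=; rewrite ifF//.
  by apply/negbTE; rewrite negb_and -ltNge zk orbT.
apply: sumr_le0 => m _; apply: mulr_ge0_le0; first exact: D2_phi_ge0.
apply: sumr_le0 => j _; apply: (le_trans (ex_le m j)) => /=.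
by case: ifP => // /andP[k0 zk]; case: nz; exists (level z m).
Qed.

End EnergyInequalities.

(** * The functional as a single integral *)

Section Translation.
Local Open Scope classical_set_scope.
Variable R : realType.
Let mu := @lebesgue_measure R.

Definition translation (a : R) (x : measurableTypeR R) : measurableTypeR R := a + x.

Lemma measurable_translation a : measurable_fun setT (translation a).
Proof. exact: measurable_funD. Qed.

HB.instance Definition _ a :=
  isMeasurableFun.Build _ _ _ _ (translation a) (measurable_translation a).

(** By uniqueness of Lebesgue measure only half-open intervals need checking, and their preimages
    have the same length. *)
Lemma lebesgue_measure_translation (a : R) (A : set R) : measurable A ->
  pushforward mu (translation a) A = mu A.
Proof.
move=> mA; apply/esym/lebesgue_measure_unique => //= _ [[b c]] _ <-.
rewrite /pushforward (_ : _ @^-1` _ = `]b - a, c - a]); last first.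
  by apply/seteqP; split => x /=; rewrite /translation !in_itv/=; move=> /andP[h1 h2]; apply/andP; split; lra.
rewrite /mu !lebesgue_measure_itv/= !lte_fin ltrD2r -!EFinB.
by case: ifP => // _; congr (_%:E); ring.
Qed.

Lemma ge0_integral_translation (a : R) (f : R -> \bar R) :
  measurable_fun [set: R] f -> (forall r, (0 <= f r)%E) ->
  (\int[mu]_y f y = \int[mu]_z f (a + z)%R)%E.
Proof.
move=> mf f0.
transitivity (\int[pushforward mu (translation a)]_y f y)%E.
  by apply: eq_measure_integral => //= A mA _; exact/esym/lebesgue_measure_translation.
by rewrite ge0_integral_pushforward.
Qed.

End Translation.

(** * Tonelli's theorem in the variables [x] and [z] *)

Section Fubini.
Local Open Scope classical_set_scope.
Variables (R : realType) (n : nat) (p s : R).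
Local Notation T := n.+1.
Let mu := @lebesgue_measure R.
Let D : set R := `[0%R, T%:R].
Implicit Types (X : 'I_T -> R).

Definition weight (z : R) : R := (`|z| `^ (1 + s * p))^-1.

Lemma weight_ge0 z : 0 <= weight z.
Proof. by rewrite invr_ge0 powR_ge0. Qed.

Lemma measurable_weight : measurable_fun [set: R] weight.
Proof.
rewrite /weight; under eq_fun do rewrite -powRN.
apply: (measurableT_comp (measurable_powR _)) => //.
Qed.

Lemma measurable_u_of X : measurable_fun [set: R] (u_of X).
Proof.
rewrite /u_of; apply: measurable_funB => //; apply: measurable_sum => i.
apply: nondecreasing_measurable => // x y xy.
by rewrite ler_int; apply: le_floor; rewrite ler_wpM2r ?invr_ge0// lerD2r.
Qed.

(** The indicator of the period lets both variables range over the whole line. *)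
Let h X (w : R * R) : \bar R :=
  ((`|u_of X w.1 - u_of X (w.1 + w.2)| `^ p * weight w.2) * \1_D w.1)%:E.

Let measurable_h X : measurable_fun [set: R * R] (h X).
Proof.
apply/measurable_EFinP; apply: measurable_funM; first apply: measurable_funM.
- apply: (measurableT_comp (measurable_powR _)).
  apply: measurableT_comp => //; apply: measurable_funB.
    by apply: (measurableT_comp (measurable_u_of X)).
  by apply: (measurableT_comp (measurable_u_of X)); apply: measurable_funD.
- by apply: (measurableT_comp measurable_weight).
- have mI : measurable_fun [set: R] (\1_D : R -> R) by apply: measurable_indic; exact: measurable_itv.
  by apply: (measurableT_comp mI); exact: measurable_fst.
Qed.

Let h_ge0 X w : (0 <= h X w)%E.
Proof. by rewrite lee_fin !mulr_ge0 ?powR_ge0 ?weight_ge0. Qed.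

Let integral_h X z : cyc X -> (\int[mu]_x h X (x, z) = (energy p X z * weight z)%:E)%E.
Proof.
move=> cX; have [I E] := has_integral_energy p z cX.
transitivity (\int[mu]_(x in D) (h X (x, z)))%E.
  rewrite [RHS]integral_mkcond; apply: eq_integral => x _.
  rewrite patchE; case: ifPn => // xD.
  by rewrite /h indicE (negbTE xD) mulr0.
rewrite mulrC EFinM -E -ge0_integralZl//; last 2 first.
- by case/integrableP: I.
- by rewrite lee_fin weight_ge0.
by apply: eq_integral => x xD; rewrite /h indicE xD mulr1/= mulrC EFinM.
Qed.

(** The function is a partial integral of [h], hence measurable by Tonelli; this avoids the closed
    form, whose nodes jump with [z]. *)
Lemma measurable_energy X : cyc X ->
  measurable_fun [set: R] (fun z => (energy p X z * weight z)%:E).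
Proof.
move=> cX; have := measurable_fun_fubini_tonelli_G (m1 := mu) (h X) (measurable_h X) (h_ge0 X).
by rewrite /fubini_G; under eq_fun do rewrite integral_h//.
Qed.

Lemma energy_ge0 X z : cyc X -> 0 <= energy p X z.
Proof.
move=> cX; have [_ E] := has_integral_energy p z cX.
by rewrite -lee_fin -E; apply: integral_ge0 => x _; rewrite lee_fin powR_ge0.
Qed.

Lemma Fsp_energy X : cyc X ->
  Fsp s p X = (\int[mu]_z (energy p X z * weight z)%:E)%E.
Proof.
move=> cX.
transitivity (\int[mu]_z \int[mu]_x h X (x, z))%E; last first.
  by apply: eq_integral => z _; rewrite integral_h.
rewrite -(fubini_tonelli (m1 := mu) (m2 := mu) (h X) (measurable_h X) (h_ge0 X)).
rewrite /Fsp integral_mkcond; apply: eq_integral => x _.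
rewrite patchE; case: ifP => xD; last first.
  by apply/esym/integral0_eq => z _; rewrite /h indicE xD mulr0.
(* Substitution [y = x + z] in the inner integral. *)
rewrite (ge0_integral_translation x); last 2 first.
- apply/measurable_EFinP; apply: measurable_funM.
    apply: (measurableT_comp (measurable_powR _)).
    by apply: measurableT_comp => //; apply: measurable_funB => //; exact: measurable_u_of.
  have -> : (fun y => (`|x - y| `^ (1 + s * p))^-1) = weight \o (fun y => x - y) by [].
  by apply: (measurableT_comp measurable_weight); apply: measurable_funB.
- by move=> r; rewrite lee_fin mulr_ge0 ?powR_ge0// invr_ge0 powR_ge0.
apply: eq_integral => z _; rewrite /h indicE xD mulr1/= /weight.
rewrite (_ : x - (x + z) = - z) ?normrN//; last ring.
Qed.

End Fubini.

(** * Finiteness *)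

Section GeometricCover.
Local Open Scope classical_set_scope.
Variable R : realType.
Let mu := @lebesgue_measure R.

(** Once the cover is made disjoint, piece [k] contributes at most [c k] times the length of
    [[- r k, r k]], and a geometric series bounds the total. *)
Lemma cover_integral_lty (f : R -> R) (F : nat -> set R) (c r : nat -> R) (C q : R) :
  measurable_fun [set: R] f -> (forall z, 0 <= f z) ->
  (forall k, measurable (F k)) ->
  (forall k z, F k z -> `|z| <= r k /\ f z <= c k) ->
  (forall k, 0 <= r k) -> (forall k, 0 <= c k) ->
  (forall k, c k * (2 * r k) <= C * q ^+ k) -> 0 <= C -> 0 < q < 1 ->
  (\int[mu]_(z in \bigcup_k F k) (f z)%:E < +oo)%E.
Proof.
move=> mf f0 mF Fle r0 c0 cr C0 /andP[q0 q1].
have mS := seqDU_measurable mF.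
have mEf : measurable_fun [set: R] (EFin \o f) by exact/measurable_EFinP.
rewrite seqDU_bigcup_eq ge0_integral_bigcup//; last 2 first.
- exact: measurable_funTS mEf.
- by move=> z _; rewrite lee_fin.
apply: (@le_lt_trans _ _ (C / (1 - q))%:E); last by rewrite ltry.
apply: lime_le; first by apply: is_cvg_nneseries => k _ _; apply: integral_ge0 => z _; rewrite lee_fin.
near=> m.
apply: (@le_trans _ _ (\sum_(0 <= k < m) (C * q ^+ k)%:E)%E).
  apply: lee_sum => k _.
  apply: (@le_trans _ _ (\int[mu]_(z in seqDU F k) (c k)%:E)%E).
    apply: ge0_le_integral.
    - exact: mS.
    - by move=> z _; rewrite lee_fin.
    - exact: measurable_funTS mEf.
    - exact: measurable_cst.
    - by move=> z zS; rewrite lee_fin; have [] := Fle k z (@subset_seqDU _ F k z zS).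
  rewrite integral_cst; last exact: mS.
  apply: (@le_trans _ _ ((c k)%:E * (2 * r k)%:E)%E); last first.
    by rewrite -EFinM lee_fin.
  apply: lee_wpmul2l; first by rewrite lee_fin.
  apply: (@le_trans _ _ (mu `[- r k, r k])).
    apply: le_measure; rewrite ?inE; [exact: mS|exact: measurable_itv|].
    move=> z zS; rewrite /= in_itv/= -ler_norml.
    by have [] := Fle k z (@subset_seqDU _ F k z zS).
  rewrite /mu lebesgue_measure_itv/= lte_fin; case: ifP => _; last by rewrite lee_fin mulr_ge0.
  by rewrite -EFinB lee_fin; lra.
rewrite sumEFin lee_fin.
by have := @geometric_le_lim R m C q C0 q0; rewrite gtr0_norm// => /(_ q1).
Unshelve. all: by end_near. Qed.

Lemma measurable_norm_itv (a b : R) : measurable [set z : R | a <= `|z| <= b].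
Proof.
have -> : [set z : R | a <= `|z| <= b] = (fun z : R => `|z|) @^-1` `[a, b]%classic.
  by apply/seteqP; split => z /=; rewrite in_itv.
rewrite -[X in measurable X]setTI; by apply: (@normr_measurable R setT).
Qed.

Lemma dyadic_ge1 (x : R) : 1 <= x -> exists k, 2 ^+ k <= x <= 2 ^+ k.+1.
Proof.
move=> x1; have x0 : 0 <= x by lra.
have /andP[m1 m2] := truncn_itv x0; set m := Num.trunc x in m1 m2.
have m0 : (0 < m)%N by rewrite truncn_gt0.
have /andP[k1 k2] := @trunc_log_bounds 2 m isT m0.
exists (trunc_log 2 m); apply/andP; split.
  by apply: le_trans m1; rewrite -natrX ler_nat.
by apply/ltW/(lt_le_trans m2); rewrite -natrX ler_nat.
Qed.

Lemma dyadic_le1 (x : R) : 0 < x <= 1 -> exists k, 2 ^- k.+1 <= x <= 2 ^- k.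
Proof.
move=> /andP[x0 x1]; have [|k /andP[k1 k2]] := @dyadic_ge1 x^-1; first by rewrite invf_ge1.
exists k; rewrite -[x]invrK !lef_pV2 ?posrE ?exprn_gt0 ?invr_gt0//.
by rewrite k2 k1.
Qed.

(** Dyadic shells: with [Q] equal to 2 to the power [1 + s * p], the shells near 0 give a geometric
    series of ratio [Q / 4] and those near infinity one of ratio [2 / Q]. Both converge, since
    [0 < s * p < 1] means [2 < Q < 4]. *)
Lemma min_norm_weight_lty (s p : R) : 0 < s * p < 1 ->
  (\int[mu]_z (Num.min `|z| 1 * weight p s z)%:E < +oo)%E.
Proof.
move=> /andP[a0 a1]; set a := s * p in a0 a1.
pose f z := Num.min `|z| 1 * weight p s z; change (\int[mu]_z (f z)%:E < +oo)%E.
have f0 z : 0 <= f z by rewrite mulr_ge0 ?weight_ge0// le_min normr_ge0 ler01.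
have mf : measurable_fun [set: R] f.
  apply: measurable_funM; last exact: measurable_weight.
  by apply: measurable_minr => //.
have mEf : measurable_fun [set: R] (EFin \o f) by exact/measurable_EFinP.
set Q : R := 2 `^ (1 + a).
have Qk k : (2 ^+ k) `^ (1 + a) = Q ^+ k :> R.
  by rewrite -powR_mulrn// powRAC powR_mulrn// powR_ge0.
have two_lt b : 0 < b -> 1 < 2 `^ b :> R.
  move=> b0; have e1 : 1 `^ b = 1 :> R by rewrite powR1.
  by rewrite -[ltLHS]e1; apply: gt0_ltr_powR => //; rewrite ?nnegrE ?ltr1n.
have QE : Q = 2 * 2 `^ a by rewrite /Q powRD ?powRr1//; apply/implyP => _; rewrite pnatr_eq0.
have Q2 : 2 < Q by rewrite QE; have := two_lt _ a0; lra.
have Q4 : Q < 4.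
  have h : 2 `^ a * 2 `^ (1 - a) = 2 :> R.
    rewrite -powRD; first by rewrite addrC subrK powRr1.
    by apply/implyP => _; rewrite pnatr_eq0.
  have h1 : 1 < 2 `^ (1 - a) :> R by apply: two_lt; lra.
  have h2 : 0 < 2 `^ a :> R by rewrite powR_gt0.
  rewrite QE; nra.
have Q0 : 0 < Q by lra.
have w_le (t z : R) k : 0 < t -> t <= `|z| -> t `^ (1 + a) = k -> weight p s z <= k^-1.
  move=> t0 tz <-; rewrite /weight lef_pV2 ?posrE ?powR_gt0//; last by rewrite (lt_le_trans t0).
  by apply: ge0_ler_powR; rewrite ?nnegrE//; [lra | exact: ltW].
(* The point 0 lies in no shell and is adjoined to each; the integrand vanishes there. *)
pose A := \bigcup_k ([set 0] `|` [set z : R | 2 ^- k.+1 <= `|z| <= 2 ^- k]).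
pose B := \bigcup_k [set z : R | 2 ^+ k <= `|z| <= 2 ^+ k.+1].
have mA : measurable A.
  by apply: bigcup_measurable => k _; apply: measurableU => //; exact: measurable_norm_itv.
have mB : measurable B by apply: bigcup_measurable => k _; exact: measurable_norm_itv.
have IA : (\int[mu]_(z in A) (f z)%:E < +oo)%E.
  apply: (@cover_integral_lty f _ (fun k => 2 ^- k * Q ^+ k.+1) (fun k => 2 ^- k) (2 * Q) (Q / 4)) => //.
  - by move=> k; apply: measurableU => //; exact: measurable_norm_itv.
  - move=> k z [->|/andP[z1 z2]].
      rewrite normr0 invr_ge0 exprn_ge0//; split => //.
      by rewrite /f normr0 min_l// mul0r mulr_ge0 ?invr_ge0 ?exprn_ge0// ltW.
    split => //; apply: ler_pM; rewrite ?weight_ge0 ?le_min ?normr_ge0 ?ler01//.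
      by apply: (le_trans _ z2); rewrite ge_min lexx.
    rewrite -[Q ^+ _]invrK; apply: w_le z1 _; first by rewrite invr_gt0 exprn_gt0.
    apply: (mulIf (lt0r_neq0 (exprn_gt0 k.+1 Q0))); rewrite mulVf ?expf_neq0 ?gt_eqF//.
    rewrite -Qk -powRM ?invr_ge0 ?exprn_ge0//.
    by rewrite mulVf ?powR1// expf_neq0// pnatr_eq0.
  - by move=> k; rewrite mulr_ge0 ?invr_ge0 ?exprn_ge0// ltW.
  - move=> k; rewrite le_eqVlt; apply/orP; left; apply/eqP.
    rewrite exprMn exprVn exprS (_ : 4 = 2 * 2 :> R); last by ring.
    by rewrite exprMn; field; rewrite expf_neq0// pnatr_eq0.
  - by rewrite mulr_ge0// ltW.
  - by apply/andP; split; lra.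
have IB : (\int[mu]_(z in B) (f z)%:E < +oo)%E.
  apply: (@cover_integral_lty f _ (fun k => Q ^- k) (fun k => 2 ^+ k.+1) 4 (2 / Q)) => //.
  - by move=> k; exact: measurable_norm_itv.
  - move=> k z /andP[z1 z2]; split => //.
    rewrite -[Q ^- k]mul1r; apply: ler_pM; rewrite ?weight_ge0 ?le_min ?normr_ge0 ?ler01//.
    by apply: w_le z1 _; rewrite ?Qk// exprn_gt0.
  - by move=> k; rewrite invr_ge0 exprn_ge0// ltW.
  - move=> k; rewrite le_eqVlt; apply/orP; left; apply/eqP.
    rewrite exprMn exprVn exprS (_ : 4 = 2 * 2 :> R); last by ring.
    by field; rewrite expf_neq0// gt_eqF.
  - by rewrite divr_gt0//= ltr_pdivrMr//; lra.
rewrite -(setvU A) ge0_integral_setU//; last 4 first.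
- exact: measurableC.
- exact: measurable_funTS mEf.
- by move=> z _; rewrite lee_fin.
- by apply/disj_set2P; rewrite setICl.
apply: lte_add_pinfty => //.
apply: le_lt_trans IB; apply: ge0_subset_integral => //.
- exact: measurableC.
- exact: measurable_funTS mEf.
- by move=> z _; rewrite lee_fin.
move=> z nA; have [z1|z1] := leP 1 `|z|.
  by have [k hk] := dyadic_ge1 z1; exists k.
exfalso; apply: nA; have [->|z0] := eqVneq z 0; first by exists 0%N => //; left.
have [|k hk] := @dyadic_le1 `|z|; first by rewrite normr_gt0 z0 ltW.
by exists k => //; right.
Qed.

End GeometricCover.

(** * Bounds on [energy] and finiteness of the functional *)

Section Finiteness.
Local Open Scope classical_set_scope.
Variables (R : realType) (n : nat) (p s : R).
Local Notation T := n.+1.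
Implicit Types (X : 'I_T -> R).
Hypothesis p1 : 1 <= p.

Let p0 : 0 <= p. Proof. exact: le_trans p1. Qed.

Lemma has_integral_le (f g : R -> R) (a b : R) :
  has_integral n f a -> has_integral n g b ->
  (forall x, 0 <= x <= T%:R -> f x <= g x) -> a <= b.
Proof.
move=> [If Ef] [Ig Eg] fg; rewrite -lee_fin -Ef -Eg; apply: le_integral => //.
by move=> x; rewrite inE/= in_itv/= => /fg; rewrite lee_fin.
Qed.

(** The increment [v] of [u] is at most [T] in modulus, which gives the bound for large [z]. For
    small [z], [v / T <= 1] and [p >= 1] bound the power of [v] by [v] times that of [T], and the
    integral of [v] over a period is at most [2 * |z| * T]. *)
Lemma energy_le X z : cyc X ->
  energy p X z <= 2 * T%:R `^ p * T%:R * Num.min `|z| 1.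
Proof.
move=> cX; set c := T%:R `^ p.
have T1 : 1 <= T%:R :> R by rewrite ler1n.
have T0 : 0 < T%:R :> R by rewrite ltr0n.
have c0 : 0 <= c by exact: powR_ge0.
have bd x : `|u_of X x - u_of X (x + z)| <= T%:R.
  rewrite u_of_cnt; have /andP[h1 h2] := cnt_bound X x z.
  by rewrite ler_norml; apply/andP; split; lra.
have h1 : energy p X z <= c * T%:R.
  apply: (has_integral_le (has_integral_energy p z cX) (has_integral_cst n c)) => x _.
  by apply: ge0_ler_powR; rewrite ?nnegrE ?normr_ge0// ltW.
have h2 : energy p X z <= c * (`|z| * T%:R + `|z| * T%:R).
  (* The count has the sign of [z], so its absolute value integrates exactly. *)
  have sgE : has_integral n (fun x => `|(cnt X x z)%:~R|) (`|z| * T%:R).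
    have [z0|/ltW z0] := leP 0 z.
      rewrite ger0_norm//; apply: has_integral_ext (has_integral_cnt X z) => x _.
      by rewrite ger0_norm// ler0z cnt_ge0.
    rewrite ler0_norm//.
    have := has_integralZ (-1) (has_integral_cnt X z).
    rewrite mulN1r -mulNr; apply: has_integral_ext => x _.
    by rewrite ler0_norm ?mulN1r// lerz0 cnt_le0.
  have := has_integralZ c (has_integralD sgE (has_integral_cst n `|z|)).
  move/(has_integral_le (has_integral_energy p z cX)); apply => x _.
  set v := `|u_of X x - _|.
  have vT : v <= `|(cnt X x z)%:~R| + `|z|.
    by rewrite /v u_of_cnt (le_trans (ler_normB _ _)).
  have v_ge0 : 0 <= v by exact: normr_ge0.
  have := bd x; rewrite -/v; move: v vT v_ge0 => v vT v_ge0 vT'.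
  apply: (@le_trans _ _ (c * v)); last by rewrite ler_wpM2l.
  have {1}-> : v = T%:R * (v / T%:R) by field; rewrite gt_eqF.
  rewrite powRM ?(ltW T0) ?divr_ge0 ?(ltW T0)// -/c.
  apply: ler_wpM2l => //.
  have [->|v0] := eqVneq v 0; first by rewrite mul0r powR0 ?mulr0// gt_eqF// (lt_le_trans _ p1).
  have v1 : 0 < v by rewrite lt_neqAle eq_sym v0.
  apply: (@le_trans _ _ (v / T%:R)).
    apply: ge1r_powR => //; rewrite divr_gt0//= ler_pdivrMr// mul1r; exact: vT'.
  by rewrite ler_pdivrMr// ler_peMr.
rewrite /Num.min; case: ifP => _; first by apply: (le_trans h2); rewrite le_eqVlt; apply/orP; left; apply/eqP; ring.
apply: (le_trans h1); rewrite mulr1 -mulrA.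
have := mulr_ge0 c0 (ltW T0); move: (c * T%:R) => w; lra.
Qed.

Lemma Fsp_lty X : 0 < s -> s * p < 1 -> cyc X -> (Fsp s p X < +oo)%E.
Proof.
move=> s0 sp1 cX; rewrite Fsp_energy//.
have sp : 0 < s * p < 1 by rewrite sp1 andbT mulr_gt0// (lt_le_trans _ p1).
set C := 2 * T%:R `^ p * T%:R.
have C0 : 0 <= C by rewrite /C !mulr_ge0// powR_ge0.
apply: (@le_lt_trans _ _ (\int[lebesgue_measure]_z (C%:E * (Num.min `|z| 1 * weight p s z)%:E))%E).
  apply: ge0_le_integral => //.
  - by move=> z _; rewrite lee_fin mulr_ge0 ?energy_ge0// weight_ge0.
  - exact: measurable_energy.
  - apply: measurable_funeM; apply/measurable_EFinP; apply: measurable_funM; last exact: measurable_weight.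
    exact: measurable_minr.
  - move=> z _; rewrite -EFinM lee_fin mulrA; apply: ler_wpM2r; first exact: weight_ge0.
    exact: energy_le.
rewrite ge0_integralZl//; last 2 first.
- apply/measurable_EFinP; apply: measurable_funM; last exact: measurable_weight.
  exact: measurable_minr.
- by move=> z _; rewrite lee_fin mulr_ge0 ?weight_ge0// le_min normr_ge0 ler01.
by rewrite lte_mul_pinfty// min_norm_weight_lty.
Qed.

Lemma Fsp_ge0 X : (0 <= Fsp s p X)%E.
Proof.
apply: integral_ge0 => x _; apply: integral_ge0 => y _.
by rewrite lee_fin mulr_ge0 ?powR_ge0// invr_ge0 powR_ge0.
Qed.

(** [fine] sends infinite values to 0; finiteness makes it faithful on ordered configurations. *)
Lemma Fsp_fin_num X : 0 < s -> s * p < 1 -> cyc X -> Fsp s p X \is a fin_num.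
Proof. by move=> *; rewrite ge0_fin_numE ?Fsp_ge0 ?Fsp_lty. Qed.

End Finiteness.

(** * Minimality of the lattice *)

Section StrictIntegral.
Variable R : realType.
Let mu := @lebesgue_measure R.

(** The finite integral of [g] can be subtracted, so that the nonnegative [f - g] has integral zero
    and vanishes almost everywhere. *)
Lemma ge0_integral_le_ae (f g : R -> R) :
  measurable_fun [set: R]%classic f -> measurable_fun [set: R]%classic g ->
  (forall z, 0 <= g z <= f z) ->
  (\int[mu]_z (f z)%:E <= \int[mu]_z (g z)%:E < +oo)%E ->
  exists A, [/\ measurable A, mu A = 0%E & forall z, f z <> g z -> A z].
Proof.
move=> mf mg gf /andP[fg goo].
have g0 z : 0 <= g z by case/andP: (gf z).
pose d z := f z - g z.
have d0 z : 0 <= d z by rewrite subr_ge0; case/andP: (gf z).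
have md : measurable_fun [set: R]%classic d by exact: measurable_funB.
have E : (\int[mu]_z (f z)%:E = \int[mu]_z (g z)%:E + \int[mu]_z (d z)%:E)%E.
  rewrite -ge0_integralD//.
  - by apply: eq_integral => z _; rewrite -EFinD /d addrC subrK.
  - by move=> z _; rewrite lee_fin.
  - by apply/measurable_EFinP.
  - by move=> z _; rewrite lee_fin.
  - by apply/measurable_EFinP.
have Ig : (0 <= \int[mu]_z (g z)%:E)%E by apply: integral_ge0 => z _; rewrite lee_fin.
have Id : (0 <= \int[mu]_z (d z)%:E)%E by apply: integral_ge0 => z _; rewrite lee_fin.
have {fg goo Ig}Id : (\int[mu]_z (d z)%:E = 0)%E.
  move: fg goo Ig Id; rewrite E; move: (\int[mu]_z (g z)%:E)%E (\int[mu]_z (d z)%:E)%E.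
  move=> [a| |] [b| |]//; rewrite -EFinD !lee_fin => h _ _ b0.
  by congr (_%:E); lra.
have : ae_eq mu [set: R]%classic (EFin \o d) (cst 0%E).
  apply/(ae_eq_integral_abs mu measurableT); first by apply/measurable_EFinP.
  by rewrite -[RHS]Id; apply: eq_integral => z _; rewrite /= ger0_norm.
case=> A [mA A0 dA]; exists A; split => // z fgz; apply: dA => /= /(_ I) -[dz].
by apply: fgz; apply/eqP; rewrite -subr_eq0; apply/eqP.
Qed.

End StrictIntegral.

(** * Convexity of the functional and rigidity of its minimisers *)

Section Minimality.
Local Open Scope classical_set_scope.
Variables (R : realType) (n : nat) (p s : R).
Local Notation T := n.+1.
Implicit Types (X Y : 'I_T -> R).
Hypotheses (p1 : 1 <= p) (s0 : 0 < s) (sp1 : s * p < 1).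
Let mu := @lebesgue_measure R.
Let F X := fine (Fsp s p X).
Let density X z := energy p X z * weight p s z.

Let density_ge0 X z : cyc X -> 0 <= density X z.
Proof. by move=> cX; rewrite mulr_ge0 ?weight_ge0// energy_ge0. Qed.

Let mdensity X : cyc X -> measurable_fun [set: R] (density X).
Proof. by move=> cX; apply/measurable_EFinP; exact: measurable_energy. Qed.

Let FE X : cyc X -> (\int[mu]_z (density X z)%:E = (F X)%:E)%E.
Proof. by move=> cX; rewrite /F fineK ?Fsp_fin_num// Fsp_energy. Qed.

(** This is [energy_convex] integrated against the weight. Combinations of any length are allowed
    for the sake of the [T + 1] terms in [convex_barycentre]. *)
Lemma Fsp_convex (m : nat) (l : 'I_m -> R) (Y : 'I_m -> 'I_T -> R) :
  (forall a, 0 <= l a) -> \sum_a l a = 1 -> (forall a, cyc (Y a)) ->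
  fine (Fsp s p (fun i => \sum_a l a * Y a i)) <= \sum_a l a * fine (Fsp s p (Y a)).
Proof.
move=> l0 l1 cY; rewrite -lee_fin -FE; last exact: cyc_comb.
have -> : (\sum_a l a * fine (Fsp s p (Y a)))%:E =
    (\int[mu]_z (\sum_(a < m) ((l a)%:E * (density (Y a) z)%:E)))%E.
  rewrite ge0_integral_sum//.
  - rewrite -sumEFin; apply: eq_bigr => a _; rewrite EFinM -FE// ge0_integralZl//.
    + by apply/measurable_EFinP; exact: mdensity.
    + by move=> z _; rewrite lee_fin density_ge0.
    + by rewrite lee_fin.
  - by move=> a; apply: measurable_funeM; apply/measurable_EFinP; exact: mdensity.
  - by move=> a z _; rewrite mule_ge0 ?lee_fin// density_ge0.
apply: ge0_le_integral => //.
- by move=> z _; rewrite lee_fin density_ge0//; exact: cyc_comb.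
- apply/measurable_EFinP; apply: mdensity; exact: cyc_comb.
- apply: emeasurable_sum => a; apply: measurable_funeM.
  by apply/measurable_EFinP; exact: mdensity.
move=> z _; under eq_bigr do rewrite -EFinM.
rewrite sumEFin lee_fin /density; under eq_bigr do rewrite mulrA.
by rewrite -mulr_suml; apply: ler_wpM2r; [exact: weight_ge0|exact: energy_convex].
Qed.

Lemma Fsp_Xeq_le X : cyc X -> (Fsp s p (@Xeq R T) <= Fsp s p X)%E.
Proof.
move=> cX; rewrite !Fsp_energy//; last exact: cyc_Xeq.
apply: ge0_le_integral => //.
- by move=> z _; rewrite lee_fin density_ge0//; exact: cyc_Xeq.
- by apply: measurable_energy; exact: cyc_Xeq.
- exact: measurable_energy.
- by move=> z _; rewrite lee_fin ler_wpM2r ?weight_ge0// energy_Xeq_le.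
Qed.

Lemma weight_gt0 z : 0 < z -> 0 < weight p s z.
Proof. by move=> z0; rewrite invr_gt0 powR_gt0// normr_gt0 gt_eqF. Qed.

(* A gap smaller than 1 makes the energy density strictly larger than that of the lattice on a whole interval of [z]. *)
Lemma Fsp_le_gap X (i : 'I_T) : cyc X -> fine (Fsp s p X) <= fine (Fsp s p (@Xeq R T)) ->
  1 <= xe X ((i : nat)%:Z + 1) - xe X (i : nat).
Proof.
move=> cX FX; rewrite leNgt; apply/negP; set g := _ - _ => g1.
have cE := cyc_Xeq R n.
have [||||A [mA A0 dA]] := @ge0_integral_le_ae R (density X) (density (@Xeq R T)).
- exact: mdensity.
- exact: mdensity.
- move=> z; apply/andP; split; first exact: density_ge0.
  by rewrite /density ler_wpM2r ?weight_ge0// energy_Xeq_le.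
- by rewrite (FE cX) (FE cE) ltry lee_fin andbT; exact: FX.
(* [energy_Xeq_lt] asks for [z] positive as well as above the gap, whence the maximum with 0. *)
clear FX; pose g' := Num.max g 0.
have g'1 : g' < 1 by rewrite gt_max g1 ltr01.
pose J : set R := `]g', 1[.
have sub : J `<=` A.
  move=> z; rewrite /J /= in_itv/= => /andP[gz z1]; apply: dA => dz.
  move: gz; rewrite gt_max => /andP[gz z0].
  have z01 : 0 < z < 1 by rewrite z0 z1.
  have := energy_Xeq_lt p1 z01 gz.
  by rewrite -(ltr_pM2r (weight_gt0 z0)) -/(density _ z) -/(density X z) dz ltxx.
have : (mu J <= mu A)%E.
  by apply: le_measure; rewrite ?inE//; exact: measurable_itv.
by rewrite /mu A0 /J lebesgue_measure_itv/= lte_fin g'1 -EFinB lee_fin leNgt subr_gt0 g'1.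
Qed.

(** Every gap is at least 1 and the [T] gaps of a period add up to [T], so all equal 1. *)
Lemma Fsp_le_translate X : cyc X -> fine (Fsp s p X) <= fine (Fsp s p (@Xeq R T)) ->
  translate_of_Xeq X.
Proof.
move=> cX FX; have gap i := Fsp_le_gap i cX FX.
have gap1 (i : 'I_T) : xe X ((i : nat)%:Z + 1) - xe X (i : nat) = 1.
  have : \sum_(j < T) (xe X ((j : nat)%:Z + 1) - xe X (j : nat) - 1) = 0.
    rewrite sumrB sumrB (@sum_shift _ _ (xe X) T%:R); last first.
      by move=> j; rewrite -[T%:Z in LHS]mul1r xeDT mul1r.
    by rewrite sumr_const card_ord mulr1z; ring.
  move/eqP; rewrite psumr_eq0; last by move=> j _; rewrite subr_ge0.
  by move=> /allP/(_ i (mem_index_enum _)); rewrite implyTb => /eqP/subr0_eq.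
have XE (k : nat) : (k < T)%N -> xe X k%:Z = xe X 0 + k%:R.
  elim: k => [|k IH] kT; first by rewrite addr0.
  have := gap1 (Ordinal (ltnW kT)); rewrite /= IH; last exact: ltnW.
  have -> : k%:Z + 1 = k.+1%:Z by lia.
  by move/eqP; rewrite subr_eq => /eqP ->; rewrite -natr1; ring.
exists (xe X 0); congr perset; apply/funext => i.
by rewrite -xe_ord XE// addrC.
Qed.

End Minimality.

(** * Critical points and local minimisers of a functional convex on ordered configurations *)

Section Criticality.
Local Open Scope classical_set_scope.
Variables (R : realType) (n : nat).
Local Notation T := n.+1.
Implicit Types (X Y : 'I_T -> R).
Variable E : ('I_T -> R) -> R.
Hypothesis E_convex : forall (m : nat) (l : 'I_m -> R) (Y : 'I_m -> 'I_T -> R),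
  (forall a, 0 <= l a) -> \sum_a l a = 1 -> (forall a, cyc (Y a)) ->
  E (fun i => \sum_a l a * Y a i) <= \sum_a l a * E (Y a).

Lemma derive0_small (g : R -> R) (e : R) : is_derive (0 : R) (1 : R) g 0 -> 0 < e ->
  \forall h \near (0 : R), `|g h - g 0| <= e * `|h|.
Proof.
move=> [dg g0] e0; move: dg; rewrite /derivable => /cvg_ex[l gl].
have l0 : l = 0 by rewrite -g0; apply/esym/cvg_lim.
move: gl; rewrite l0 => /cvgr0Pnorm_le/(_ e e0).
rewrite -filter.nbhs_nearE.
move=> H; near=> h.
have [->|h0] := eqVneq h 0; first by rewrite subrr !normr0 mulr0.
have : `|h^-1 *: (g (h *: 1 + 0) - g 0)| <= e.
  move: h0; near: h.
  by move: H; rewrite /dnbhs /within/=.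
rewrite addr0 /GRing.scale/= mulr1 normrM normfV mulrC ler_pdivrMr ?normr_gt0//.
Unshelve. all: by end_near. Qed.

Lemma small_is_derive0 (g : R -> R) :
  (forall e : R, 0 < e -> \forall h \near (0 : R), `|g h - g 0| <= e * `|h|) ->
  is_derive (0 : R) (1 : R) g 0.
Proof.
move=> H.
have C : h^-1 *: ((g \o shift 0) (h *: 1) - g 0) @[h --> 0^'] --> (0 : R).
  apply/cvgr0Pnorm_le => e e0; have := H e e0.
  rewrite /dnbhs/= => He; rewrite !near_withinE; near=> h => h0.
  have hg : `|g h - g 0| <= e * `|h| by near: h.
  by rewrite /= addr0 /GRing.scale/= mulr1 normrM normfV mulrC ler_pdivrMr ?normr_gt0.
by apply: DeriveDef; [apply/cvg_ex; exists 0|apply/cvg_lim].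
Unshelve. all: by end_near. Qed.

(** The points are distinct in [[0, T)], so the finitely many inequalities of [cyc] between
    different indices are strict and leave room for [h]. *)
Lemma cyc_perturb_near X : inX0T X ->
  \forall h \near (0 : R), forall i : 'I_T, cyc (perturb X i h).
Proof.
move=> [[X0 Xle] Xd].
have lt (i j : 'I_T) : (i < j)%N -> X i < X j.
  move=> ij; rewrite lt_neqAle Xle ?andbT; last exact: ltnW.
  have : i != j by apply/eqP => e; move: ij; rewrite e ltnn.
  by move=> /Xd; rewrite normr_gt0 subr_eq0.
have lt' (i j : 'I_T) : X i < X j + T%:R.
  by have /andP[_ +] := X0 i; have /andP[+ _] := X0 j; lra.
have nle (c : R) : 0 < c -> \forall h \near (0 : R), `|h| <= c.
  move=> c0; apply/nbhs_ballP; exists c => //= h.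
  by rewrite /ball/= sub0r normrN => /ltW.
have H : \forall h \near (0 : R), forall ij : 'I_T * 'I_T,
    ((ij.1 < ij.2)%N -> `|h| <= X ij.2 - X ij.1) /\ `|h| <= X ij.1 + T%:R - X ij.2.
  apply: (@filter_forall R _ (fun (ij : 'I_T * 'I_T) (h : R) =>
    ((ij.1 < ij.2)%N -> `|h| <= X ij.2 - X ij.1) /\ `|h| <= X ij.1 + T%:R - X ij.2)
    (nbhs (0 : R)) _) => -[i j] /=.
  have p2 : 0 < X i + T%:R - X j by rewrite subr_gt0.
  case ij: (i < j)%N; last by near=> h; split => //; near: h; exact: nle.
  have p1 : 0 < X j - X i by rewrite subr_gt0 lt.
  by near=> h; split => [_|]; near: h; exact: nle.
apply: filterS H => h H i.
have hle : h <= `|h| by exact: ler_norm.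
have hle' : - h <= `|h| by rewrite -normrN; exact: ler_norm.
split=> [a b|a b].
  rewrite leq_eqVlt => /orP[/eqP/val_inj->//|ab].
  have := (H (a, b)).1 ab; rewrite /perturb /=.
  by case: ifP => _; case: ifP => _; lra.
have [->|ab] := eqVneq a b; first by rewrite lerDl.
have := (H (a, b)).2; rewrite /perturb /=.
by case: ifP => _; case: ifP => _; lra.
Unshelve. all: by end_near. Qed.

Lemma inX0T_Xeq : inX0T (@Xeq R T).
Proof.
split; first split.
- by move=> i; rewrite ler0n ltr_nat ltn_ord.
- by move=> i j ij; rewrite ler_nat.
- by move=> i j ij; rewrite normr_gt0 subr_eq0 eqr_nat.
Qed.

(* [X] is the barycentre of [Xeq], with weight [t / (1 + t)], and of the [T] one-point perturbations of [X] by [- t T (Xeq i - X i)], with weight [1 / (T (1 + t))] each. *)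
Lemma convex_barycentre X (t : R) : cyc X -> 0 < t ->
  (forall i, cyc (perturb X i (- (t * T%:R * (Xeq R i - X i))))) ->
  (1 + t) * E X <= t * E (@Xeq R T) +
    T%:R^-1 * \sum_i E (perturb X i (- (t * T%:R * (Xeq R i - X i)))).
Proof.
move=> cX t0 cY; pose P i := perturb X i (- (t * T%:R * (Xeq R i - X i))).
rewrite -[X in _ <= _ + _ * X]/(\sum_i E (P i)).
have T0 : T%:R != 0 :> R by rewrite pnatr_eq0.
have t1 : 1 + t != 0 by rewrite gt_eqF//; lra.
(* Index [ord0] carries the lattice, the other [T] indices the perturbations. *)
pose l (a : 'I_T.+1) := if unlift ord0 a is Some _ then (T%:R * (1 + t))^-1 else t / (1 + t).
pose Y (a : 'I_T.+1) := if unlift ord0 a is Some i then P i else @Xeq R T.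
have l0 a : 0 <= l a.
  rewrite /l; case: unliftP => [i _|_].
    by rewrite invr_ge0 mulr_ge0//; lra.
  by rewrite divr_ge0//; lra.
have sumE (V : 'I_T -> R) (v : R) :
    \sum_a l a * (if unlift ord0 a is Some i then V i else v) =
    t / (1 + t) * v + (T%:R * (1 + t))^-1 * \sum_i V i.
  rewrite big_ord_recl /l unlift_none; congr (_ + _).
  by rewrite mulr_sumr; apply: eq_bigr => i _; rewrite liftK.
have l1 : \sum_a l a = 1.
  have := sumE (fun=> 1) 1; rewrite sumr_const card_ord => S1.
  transitivity (t / (1 + t) * 1 + (T%:R * (1 + t))^-1 * T%:R).
    by rewrite -S1; apply: eq_bigr => a _; case: unliftP => *; rewrite mulr1.
  by move: (T%:R : R) T0 => u u0; field; rewrite u0 t1.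
have cYa a : cyc (Y a) by rewrite /Y; case: unliftP => [i _|_]; [exact: cY|exact: cyc_Xeq].
have := E_convex l0 l1 cYa.
have -> : (fun i => \sum_a l a * Y a i) = X.
  apply/funext => j; rewrite /Y.
  transitivity (\sum_a l a * (if unlift ord0 a is Some i then P i j else Xeq R j)).
    by apply: eq_bigr => a _; case: unliftP.
  rewrite sumE.
  (* Only the [j]-th perturbation moves coordinate [j]. *)
  have -> : \sum_i P i j = T%:R * X j - t * T%:R * (Xeq R j - X j).
    rewrite (bigD1 j)//= {1}/P /perturb eqxx.
    rewrite (eq_bigr (fun=> X j)); last by move=> i ij; rewrite /P /perturb eq_sym (negbTE ij).
    rewrite sumr_const cardC1 card_ord/= -[X j *+ n]mulr_natl -natr1; ring.
  move: (Xeq R j) (X j) (T%:R : R) T0 => a b u u0; field; rewrite u0 t1//.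
have -> : \sum_a l a * E (Y a) =
    \sum_a l a * (if unlift ord0 a is Some i then E (P i) else E (@Xeq R T)).
  by apply: eq_bigr => a _; rewrite /Y; case: unliftP.
rewrite sumE => h.
have t1' : 0 < 1 + t by lra.
move: h; rewrite -(ler_pM2l t1') => /le_trans; apply.
rewrite le_eqVlt; apply/orP; left; apply/eqP.
by move: (E _) (\sum_i _) (T%:R : R) T0 => a b u u0; field; rewrite u0 t1.
Qed.

(** In [convex_barycentre] the perturbed energies differ from [E X] by [o(t)], since the partial
    derivatives vanish. Cancelling [E X] and dividing by [t] leaves the inequality up to an
    arbitrary [e]. *)
Lemma critical_le X : inX0T X ->
  (forall i, is_derive (0 : R) (1 : R) (fun h => E (perturb X i h)) 0) ->
  E X <= E (@Xeq R T).
Proof.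
move=> X0 dX; have cX := cyc_inXT X0.1.
have fin (u a b e v : R) : 0 < u -> (1 + u) * a <= u * b + (a + v) -> v <= u * e -> a <= b + e.
  move=> u0; rewrite mulrDl mul1r => h1 h2.
  by rewrite -(ler_pM2l u0) mulrDr; lra.
pose M := \sum_i `|Xeq R i - X i|.
have M0 : 0 <= M by rewrite sumr_ge0.
apply/ler_addgt0Pr => e e0.
(* [M + 1] rather than [M], which is 0 when [X] is the lattice. *)
pose e' := e / (M + 1).
have e'0 : 0 < e' by rewrite divr_gt0//; lra.
have pert0 i : perturb X i 0 = X.
  by apply/funext => j; rewrite /perturb addr0; case: ifP.
have : \forall h \near (0 : R), forall i, cyc (perturb X i h) /\
    `|E (perturb X i h) - E X| <= e' * `|h|.
  near=> h => i; split; first by move: i; near: h; exact: cyc_perturb_near.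
  move: i; near: h; apply: filter_forall => i.
  by have := derive0_small (dX i) e'0; rewrite pert0.
move=> /nbhs_ballP[d /= d0 dP].
have T0 : 0 < T%:R :> R by rewrite ltr0n.
(* Every displacement is then at most [t * T * (M + 1) = d / 2], inside the ball of radius [d]. *)
pose t := d / (T%:R * (M + 1)) / 2.
have t0 : 0 < t by rewrite !divr_gt0// mulr_gt0//; lra.
pose h i := - (t * T%:R * (Xeq R i - X i)).
have hE i : `|h i| = t * T%:R * `|Xeq R i - X i|.
  by rewrite normrN normrM ger0_norm// mulr_ge0// ltW.
have hd i : `|h i| < d.
  have vM : `|Xeq R i - X i| <= M by rewrite /M (bigD1 i)//= lerDl sumr_ge0.
  rewrite hE (@le_lt_trans _ _ (t * T%:R * (M + 1)))//.
    by apply: ler_wpM2l; [rewrite mulr_ge0// ltW|lra].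
  have -> : t * T%:R * (M + 1) = d / 2.
    rewrite /t; move: (T%:R : R) T0 => u u0; field; rewrite !gt_eqF//; lra.
  lra.
have hP i : cyc (perturb X i (h i)) /\
    `|E (perturb X i (h i)) - E X| <= e' * `|h i|.
  by move: i (hd i) => i hdi; apply: (dP (h i)); rewrite /ball/= sub0r normrN.
have := convex_barycentre cX t0 (fun i => (hP i).1).
have -> : \sum_i E (perturb X i (- (t * T%:R * (Xeq R i - X i)))) =
    T%:R * E X + \sum_i (E (perturb X i (h i)) - E X).
  by rewrite sumrB sumr_const card_ord mulr_natl addrC subrK.
have : \sum_i (E (perturb X i (h i)) - E X) <= e' * (t * T%:R) * M.
  rewrite /M mulr_sumr; apply: ler_sum => i _.
  by rewrite -mulrA -hE; apply: le_trans (ler_norm _) (hP i).2.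
have e'M : e' * M <= e.
  rewrite /e' -mulrA ler_piMr ?(ltW e0)// mulrC ler_pdivrMr ?mul1r; lra.
move: (E X) (E (@Xeq R T)) (\sum_i _) => a b c hc hab.
have : T%:R^-1 * c <= t * e.
  rewrite mulrC ler_pdivrMr// (le_trans hc)//.
  have -> : e' * (t * T%:R) * M = t * T%:R * (e' * M) by ring.
  have -> : t * e * T%:R = t * T%:R * e by ring.
  by apply: ler_wpM2l => //; rewrite mulr_ge0// ltW.
move: hab; rewrite mulrDr mulKf ?gt_eqF// => hab h2.
exact: fin hab h2.
Unshelve. all: by end_near. Qed.

Lemma inXT_conv X Y (t : R) : 0 <= t <= 1 -> inXT X -> inXT Y ->
  inXT (fun i => (1 - t) * X i + t * Y i).
Proof.
move=> /andP[t0 t1] [X0 Xle] [Y0 Yle]; split => [i|i j ij].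
  have /andP[a1 a2] := X0 i; have /andP[b1 b2] := Y0 i; apply/andP; split.
    by rewrite addr_ge0// mulr_ge0//; lra.
  have [->|tn0] := eqVneq t 0; first by lra.
  have tp : 0 < t by rewrite lt_neqAle eq_sym tn0.
  have -> : T%:R = (1 - t) * T%:R + t * T%:R :> R by ring.
  apply: ler_ltD; first by apply: ler_wpM2l; [lra|exact: ltW].
  by rewrite ltr_pM2l.
by apply: lerD; apply: ler_wpM2l => //; [lra|exact: Xle|exact: Yle].
Qed.

(** A point [Y] on the segment from [X] to the lattice, close to [X], gives
    [E X <= E Y <= (1 - t) * E X + t * E Xeq], and [t > 0] can be divided out. *)
Lemma local_min_le X (e : R) : inXT X -> 0 < e ->
  (forall Y, inXT Y -> (forall i, `|Y i - X i| < e) -> E X <= E Y) ->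
  E X <= E (@Xeq R T).
Proof.
move=> inX e0 Xmin; have cX := cyc_inXT inX.
have cE := cyc_Xeq R n.
pose M := \sum_i `|Xeq R i - X i|.
have M0 : 0 <= M by rewrite sumr_ge0.
(* This keeps [Y] within [e / 2] of [X] in every coordinate. *)
pose t := Num.min 1 (e / (M + 1) / 2).
have t0 : 0 < t by rewrite lt_min ltr01 !divr_gt0//; lra.
have t1 : t <= 1 by rewrite ge_min lexx.
have te : t <= e / (M + 1) / 2 by rewrite ge_min lexx orbT.
pose Y i := (1 - t) * X i + t * Xeq R i.
have inY : inXT Y by apply: inXT_conv; rewrite ?t1 ?ltW//; exact: inX0T_Xeq.1.
have XY : E X <= E Y.
  apply: Xmin => // i.
  have -> : Y i - X i = t * (Xeq R i - X i) by rewrite /Y; ring.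
  have vM : `|Xeq R i - X i| <= M by rewrite /M (bigD1 i)//= lerDl sumr_ge0.
  rewrite normrM gtr0_norm// (@le_lt_trans _ _ (e / (M + 1) / 2 * (M + 1)))//.
    by apply: ler_pM => //; [exact: ltW|lra].
  have -> : e / (M + 1) / 2 * (M + 1) = e / 2 by field; rewrite gt_eqF//; lra.
  lra.
pose l (a : 'I_2) := if a == ord0 then 1 - t else t.
pose Z (a : 'I_2) := if a == ord0 then X else @Xeq R T.
have l0 a : 0 <= l a by rewrite /l; case: ifP => _; [rewrite subr_ge0|exact: ltW].
have l1 : \sum_a l a = 1 by rewrite !big_ord_recl big_ord0 /l/= addr0 subrK.
have cZ a : cyc (Z a) by rewrite /Z; case: (a == ord0).
have := E_convex l0 l1 cZ.
have -> : (fun i => \sum_a l a * Z a i) = Y.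
  by apply/funext => i; rewrite !big_ord_recl big_ord0 /l /Z/= addr0.
rewrite !big_ord_recl big_ord0 /l /Z/= addr0 => h.
rewrite -(ler_pM2l t0); lra.
Qed.

End Criticality.

(** * Differentiability at the lattice *)

Lemma fine_dist_le (R : realType) (a b : \bar R) (c : R) :
  a \is a fin_num -> b \is a fin_num -> (a <= b)%E -> (b <= a + c%:E)%E ->
  `|fine b - fine a| <= c.
Proof.
case: a => [a| |]//; case: b => [b| |]// _ _; rewrite -EFinD !lee_fin => ab bac /=.
by rewrite ger0_norm ?subr_ge0// lerBlDl.
Qed.

Section LatticeCritical.
Local Open Scope classical_set_scope.
Variables (R : realType) (n : nat) (p s : R).
Local Notation T := n.+1.
Hypotheses (p1 : 1 <= p) (s0 : 0 < s) (sp1 : s * p < 1).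
Let mu := @lebesgue_measure R.

Definition near_int (h : R) : set R :=
  \bigcup_(k in [set k : int | k != 0]) [set z : R | `|z - k%:~R| <= h].

Lemma near_int_mono (h h' : R) : h <= h' -> near_int h `<=` near_int h'.
Proof. by move=> hh z [k k0 zk]; exists k => //; exact: le_trans zk hh. Qed.

Lemma measurable_near_int h : measurable (near_int h).
Proof.
rewrite /near_int bigcup_mkcond; apply: countable_bigcupT_measurable.
  exact: countableP.
move=> k; case: ifP => // _.
rewrite (_ : [set _ | _] = `[k%:~R - h, k%:~R + h]); first exact: measurable_itv.
by apply/seteqP; split => z /=; rewrite in_itv/= ler_distl.
Qed.

Lemma near_int_norm_ge h z : h <= 2^-1 -> near_int h z -> 2^-1 <= `|z|.
Proof.
move=> h2 [k /= k0 zk].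
have k1 : 1 <= `|k%:~R| :> R.
  by rewrite -intr_norm -[1]/(1%:~R) ler_int; move: k0; lia.
have := ler_normB z (z - k%:~R); rewrite opprB addrC subrK; lra.
Qed.

Lemma near_int_Nint z : z \isn't a Num.int ->
  exists2 e : R, 0 < e & forall h, h < e -> ~ near_int h z.
Proof.
move=> zN; have /andP[f1 f2] := floor_itv z.
have f1' : (Num.floor z)%:~R < z.
  rewrite lt_neqAle f1 andbT; apply: contra zN => /eqP <-; exact: intr_int.
exists (Num.min (z - (Num.floor z)%:~R) ((Num.floor z + 1)%:~R - z)).
  by rewrite lt_min !subr_gt0 f1' f2.
move=> h; rewrite lt_min => /andP[h1 h2] [k _ /=]; rewrite ler_distl => /andP[k1 k2].
have [kz|kz] := leP k (Num.floor z).
  have : k%:~R <= (Num.floor z)%:~R :> R by rewrite ler_int.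
  lra.
have : (Num.floor z + 1)%:~R <= k%:~R :> R by rewrite ler_int; lia.
lra.
Qed.

Definition near_int_weight (h z : R) : R := weight p s z * \1_(near_int h) z.

Lemma near_int_weight_ge0 h z : 0 <= near_int_weight h z.
Proof. by rewrite mulr_ge0 ?weight_ge0. Qed.

Lemma measurable_near_int_weight h : measurable_fun [set: R] (near_int_weight h).
Proof.
apply: measurable_funM; first exact: measurable_weight.
by apply: measurable_indic; exact: measurable_near_int.
Qed.

Lemma near_int_weight_le h z : h <= 2^-1 ->
  near_int_weight h z <= near_int_weight 2^-1 z.
Proof.
move=> h2; rewrite ler_wpM2l ?weight_ge0// !indicE ler_nat.
case: (boolP (z \in near_int h)) => // /set_mem/(near_int_mono h2) hz.
by rewrite mem_set.
Qed.

(** On this set [|z| >= 1/2], so 1 is at most [2 * min(|z|, 1)], which [min_norm_weight_lty]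
    handles. *)
Lemma integrable_near_int_weight : mu.-integrable [set: R] (EFin \o near_int_weight 2^-1).
Proof.
apply/integrableP; split.
  by apply/measurable_EFinP; exact: measurable_near_int_weight.
have sp : 0 < s * p < 1 by rewrite sp1 andbT mulr_gt0// (lt_le_trans _ p1).
apply: (@le_lt_trans _ _ (\int[mu]_z (2%:E * (Num.min `|z| 1 * weight p s z)%:E))%E).
  apply: ge0_le_integral => //.
  - by apply/measurable_EFinP; apply: measurableT_comp => //; exact: measurable_near_int_weight.
  - apply: measurable_funeM; apply/measurable_EFinP; apply: measurable_funM; last exact: measurable_weight.
    exact: measurable_minr.
  - move=> z _; rewrite /= ger0_norm ?near_int_weight_ge0// -EFinM lee_fin /near_int_weight indicE.
    have w0 := weight_ge0 p s z.
    case: (boolP (z \in _)) => [/set_mem/near_int_norm_ge zn|_]; last first.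
      by rewrite mulr0 !mulr_ge0// le_min normr_ge0 ler01.
    rewrite mulr1 mulrA ler_peMl//.
    have : 2^-1 <= Num.min `|z| 1 by rewrite le_min zn// invf_le1 ?ler1n.
    lra.
rewrite ge0_integralZl//; last 2 first.
- apply/measurable_EFinP; apply: measurable_funM; last exact: measurable_weight.
  exact: measurable_minr.
- by move=> z _; rewrite lee_fin mulr_ge0 ?weight_ge0// le_min normr_ge0 ler01.
by rewrite lte_mul_pinfty// min_norm_weight_lty.
Qed.

(** Dominated convergence along [h m = 1 / (2 (m + 1))]: off the integers, a countable null set, the
    integrand is eventually 0. *)
Lemma integral_near_int_weight_small (e : R) : 0 < e ->
  exists2 h : R, 0 < h <= 2^-1 & (\int[mu]_z (near_int_weight h z)%:E <= e%:E)%E.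
Proof.
move=> e0; pose h (m : nat) : R := 2^-1 * m.+1%:R^-1.
have h12 m : 0 < h m <= 2^-1.
  rewrite /h mulr_gt0//= ?invr_gt0//; rewrite ler_piMr// invf_le1 ?ltr0n//.
  by rewrite ler1n.
have cZ : countable (range (fun k : int => k%:~R : R)).
  exact: card_le_trans (card_image_le _ _) (countableP _).
have [|||||_ _] := @dominated_convergence _ _ R mu [set: R] measurableT
    (fun m z => (near_int_weight (h m) z)%:E) (cst 0%E) (EFin \o near_int_weight 2^-1).
- by move=> m; apply/measurable_EFinP; exact: measurable_near_int_weight.
- exact: measurable_cst.
- exists (range (fun k : int => k%:~R : R)); split.
  + exact: countable_measurable cZ.
  + exact: countable_lebesgue_measure0 cZ.
  + move=> z /= zN; apply: contrapT => zr; apply: zN => _.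
    have [|d d0 dz] := @near_int_Nint z.
      by apply/negP => /intrP[k zk]; apply: zr; exists k.
    apply: cvg_near_cst; near=> m.
    rewrite /near_int_weight indicE memNset ?mulr0//; apply: dz.
    rewrite /h (@le_lt_trans _ _ (m.+1%:R^-1))//.
      by rewrite ler_piMl// invf_le1 ?ler1n.
    by near: m; exact: near_infty_natSinv_lt (PosNum d0).
- exact: integrable_near_int_weight.
- apply: aeW => z m _ /=; rewrite ger0_norm ?near_int_weight_ge0// lee_fin.
  by apply: near_int_weight_le; case/andP: (h12 m).
rewrite integral0 => /fine_cvgP[fin_m cv].
move: cv => /cvgr0Pnorm_le/(_ e e0) cv.
have [m _ hm] := filterI fin_m cv; exists (h m) => //.
have {hm} [/= fm hm] := hm m (leqnn m).
rewrite -[leLHS](fineK fm) lee_fin.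
exact: le_trans (ler_norm _) hm.
Unshelve. all: by end_near. Qed.

Lemma cyc_perturb_Xeq (i : 'I_T) (h : R) : `|h| <= 1 -> cyc (perturb (@Xeq R T) i h).
Proof.
rewrite ler_norml => /andP[h1 h2]; rewrite /perturb /Xeq; split => [a b|a b].
  rewrite leq_eqVlt => /orP[/eqP/val_inj->//|ab].
  have : (a : nat)%:R + 1 <= (b : nat)%:R :> R by rewrite natr1 ler_nat.
  by case: ifP => _; case: ifP => _; lra.
have [->|ab] := eqVneq a b; first by rewrite lerDl.
have : (b : nat)%:R + 1 <= (a : nat)%:R + T%:R :> R.
  by rewrite natr1 -natrD ler_nat; have := ltn_ord b; lia.
by case: ifP => _; case: ifP => _; lra.
Qed.

(** The lattice is a minimiser, so only the increase has to be bounded from above. It is at most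
    [C * |r|] times the integral of the weight near the nonzero integers, and [h] is chosen to make
    that integral at most [e / C]. *)
Lemma is_derive_Fsp_Xeq (i : 'I_T) :
  is_derive (0 : R) (1 : R) (fun h : R => fine (Fsp s p (perturb (@Xeq R T) i h))) 0.
Proof.
apply: small_is_derive0 => e e0.
pose C : R := (T.*2.+2 * T)%:R * (2 * 2 `^ p).
have C0 : 0 < C by rewrite mulr_gt0 ?ltr0n// mulr_gt0// powR_gt0.
have [h /andP[h0 h2] hI] := integral_near_int_weight_small (divr_gt0 e0 C0).
apply/nbhs_ballP; exists h => //= r; rewrite /ball/= sub0r normrN => rh.
have r1 : `|r| <= 1 by move: rh h2; lra.
have cE := cyc_Xeq R n.
have cP := cyc_perturb_Xeq i r1.
have -> : perturb (@Xeq R T) i 0 = @Xeq R T.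
  by apply/funext => j; rewrite /perturb addr0; case: ifP.
apply: fine_dist_le; [exact: Fsp_fin_num|exact: Fsp_fin_num|exact: Fsp_Xeq_le|].
rewrite (Fsp_energy p s cE) (Fsp_energy p s cP).
apply: (@le_trans _ _ (\int[mu]_z ((energy p (@Xeq R T) z * weight p s z)%:E +
    (C * `|r|)%:E * (near_int_weight h z)%:E))%E).
  have mN : measurable_fun [set: R] (fun z => ((C * `|r|)%:E * (near_int_weight h z)%:E)%E).
    by apply: measurable_funeM; apply/measurable_EFinP; exact: measurable_near_int_weight.
  apply: ge0_le_integral => //.
  - by move=> z _; rewrite lee_fin mulr_ge0 ?energy_ge0 ?weight_ge0.
  - exact: measurable_energy.
  - by apply: emeasurable_funD => //; exact: measurable_energy.
  - move=> z _; rewrite -EFinM -EFinD lee_fin.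
    have := energy_perturb_Xeq p1 i z r1; rewrite lerBlDl => /le_trans H.
    have w0 := weight_ge0 p s z.
    (* As [|r| < h], the neighbourhood of radius [|r|] may be enlarged to the one of radius [h],
       fixed before [r]. *)
    apply: (@le_trans _ _ ((energy p (@Xeq R T) z + C * `|r| * \1_(near_int h) z) * weight p s z)).
      apply: ler_wpM2r => //; apply: H; rewrite lerD2l.
      case: asboolP => [[k k0 zk]|_]; last by rewrite !mulr_ge0// ltW.
      rewrite indicE mem_set ?mulr1//; exists k => //=.
      by apply: le_trans zk _; exact: ltW.
    by rewrite mulrDl lerD2l /near_int_weight; rewrite -!mulrA [\1__ z * _]mulrC.
rewrite ge0_integralD//; last 4 first.
- by move=> z _; rewrite lee_fin mulr_ge0 ?energy_ge0 ?weight_ge0.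
- exact: measurable_energy.
- move=> z _; rewrite -EFinM lee_fin; apply: mulr_ge0; last exact: near_int_weight_ge0.
  by rewrite mulr_ge0// ltW.
- by apply: measurable_funeM; apply/measurable_EFinP; exact: measurable_near_int_weight.
apply: leeD => //.
rewrite ge0_integralZl//; last 3 first.
- by apply/measurable_EFinP; exact: measurable_near_int_weight.
- by move=> z _; rewrite lee_fin near_int_weight_ge0.
- by rewrite lee_fin mulr_ge0// ltW.
apply: (@le_trans _ _ ((C * `|r|)%:E * (e / C)%:E)%E).
  by apply: lee_wpmul2l => //; rewrite lee_fin mulr_ge0// ltW.
rewrite -EFinM lee_fin le_eqVlt; apply/orP; left; apply/eqP.
by field; rewrite gt_eqF.
Qed.

End LatticeCritical.

Theorem mainTheorem8 (R : realType) (p s : R) (T : nat) :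
  1 <= p -> 0 < s < 1 -> s * p < 1 -> (0 < T)%N ->
  (critical_X0 s p (@Xeq R T) /\
   (forall X : 'I_T -> R, critical_X0 s p X -> translate_of_Xeq X)) /\
  [/\ local_min_XT s p (@Xeq R T),
      global_min_XT s p (@Xeq R T),
      (forall X : 'I_T -> R, local_min_XT s p X -> translate_of_Xeq X) &
      (forall X : 'I_T -> R, global_min_XT s p X -> translate_of_Xeq X)].
Proof.
move=> p1 /andP[s0 _] sp1; case: T => [|n _]; first by rewrite ltnn.
have fin (X : 'I_n.+1 -> R) : cyc X -> Fsp s p X \is a fin_num by exact: Fsp_fin_num.
have conv := @Fsp_convex R n p s p1 s0 sp1.
have trans (X : 'I_n.+1 -> R) : cyc X -> fine (Fsp s p X) <= fine (Fsp s p (@Xeq R n.+1)) ->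
    translate_of_Xeq X by exact: Fsp_le_translate.
have gmin (X : 'I_n.+1 -> R) : inXT X -> (Fsp s p (@Xeq R n.+1) <= Fsp s p X)%E.
  by move=> /cyc_inXT; exact: Fsp_Xeq_le.
have fle (X Y : 'I_n.+1 -> R) : cyc X -> cyc Y -> (Fsp s p X <= Fsp s p Y)%E ->
    fine (Fsp s p X) <= fine (Fsp s p Y).
  by move=> cX cY; exact: fine_le (fin X cX) (fin Y cY).
have inE := @inX0T_Xeq R n.
split; first split.
- by split => // i; exact: is_derive_Fsp_Xeq.
- move=> X [X0 dX]; apply: trans; first exact: cyc_inXT X0.1.
  exact: (@critical_le R n (fun X => fine (Fsp s p X)) conv X X0 dX).
split.
- split; first exact: inE.1.
  by exists 1; [exact: ltr01|move=> Y inY _; exact: gmin].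
- by split; [exact: inE.1|exact: gmin].
- move=> X [inX [e e0 Xmin]]; apply: trans; first exact: cyc_inXT.
  apply: (@local_min_le R n (fun X => fine (Fsp s p X)) conv X e inX e0) => Y inY XY.
  exact: fle (cyc_inXT inX) (cyc_inXT inY) (Xmin Y inY XY).
- move=> X [inX Xmin]; apply: trans; first exact: cyc_inXT.
  exact: fle (cyc_inXT inX) (cyc_Xeq R n) (Xmin _ inE.1).
Qed.
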